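(* Let $\{a_n\}_{n=0}^\infty$ be a sequence of complex numbers with $\sup_n|a_n|<\infty$, and suppose there exists a sequence of integers $n_j\to\infty$ such that for all integers $k<0$, $$\lim_{j\to\infty} a_{n_j+k}=0,$$ and $$\liminf_{j\to\infty}|a_{n_j}|>0 .$$ Then $f(z)=\sum_{n=0}^\infty a_n z^n$ has a strong natural boundary on $\partial\mathbb{D}$.
   Context: $\mathbb{D}=\{z\in\mathbb{C}: |z|<1\}$, $\partial\mathbb{D}$ is the unit circle, and an open interval $I\subset\partial\mathbb{D}$ means a nonempty open arc. Strong natural boundary: $f$, analytic on $\mathbb{D}$, has a strong natural boundary on $\partial\mathbb{D}$ if for every open interval $I\subset\partial\mathbb{D}$ one has $\sup_{0<r<1}\int_{e^{i\theta}\in I}|f(re^{i\theta})|\,\frac{d\theta}{2\pi}=\infty$. *)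

(* Defs.v *)
From HB Require Import structures.
From mathcomp Require Import all_boot all_order all_algebra.
From mathcomp Require Export complex.
From mathcomp Require Import all_classical all_reals all_analysis.

Set Implicit Arguments.
Unset Strict Implicit.
Unset Printing Implicit Defensive.

Import Order.TTheory GRing.Theory Num.Theory.
Import numFieldNormedType.Exports.

Local Open Scope classical_set_scope.
Local Open Scope ring_scope.
Local Open Scope complex_scope.

(* In R[i] the library norm `|z| is itself an element of R[i]; [normc z] is the
   same modulus as an element of R. The copy R[i]^o carries the topology and the
   normed-module structure of the field R[i] over itself. *)
Notation normc := ComplexField.Normc.normc.

Definition expi (R : realType) (t : R) : R[i] := cos t +i* sin t.

Definition unit_disk (R : realType) : set R[i] := [set z | normc z < 1].

(* Derivative along 1 over the scalar field R[i], i.e. the complex derivative. *)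
Definition analytic_on (R : realType) (D : set R[i]) (f : R[i]^o -> R[i]^o) :
    Prop :=
  forall z : R[i]^o, D z -> derivable f z (1 : R[i]^o).

(* No bound on b - a is imposed: for b - a > 2 pi the arc is the full circle. *)
Definition open_arc (R : realType) (I : set R[i]) : Prop :=
  exists a b : R, a < b /\ I = @expi R @` `]a, b[.

Definition arc_angles (R : realType) (I : set R[i]) : set R :=
  [set t | 0 <= t < 2 * pi /\ I (expi t)].

Definition arc_mean (R : realType) (f : R[i]^o -> R[i]^o) (I : set R[i])
    (r : R) : \bar R :=
  \int[lebesgue_measure]_(t in arc_angles I)
    (normc (f (r%:C * expi t)) / (2 * pi))%:E.

Definition strong_natural_boundary (R : realType) (f : R[i]^o -> R[i]^o) :
    Prop :=
  analytic_on (@unit_disk R) f /\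
  forall I : set R[i], open_arc I ->
    ereal_sup [set arc_mean f I r | r in `]0, 1[ ] = +oo%E.

Definition power_series (R : realType) (a : nat -> R[i]) (z : R[i]^o) :
    R[i]^o :=
  limn (series (fun n => a n * z ^+ n : R[i]^o)).

(* Value of the sequence at an integer index. The value 0 at negative indices
   is immaterial: it occurs below for finitely many terms of a limit only. *)
Definition at_int (R : realType) (a : nat -> R[i]) (m : int) : R[i]^o :=
  if m is Posz n then a n else 0.

(* Main.v *)
Require Import Defs.
From mathcomp Require Import all_boot all_order all_algebra.
From mathcomp Require Import all_classical all_reals all_analysis.
From mathcomp Require Import measurable_realfun ring lra zify.

(** Suppose that the means of |f| over concentric arcs stay bounded for one arc
    I. The idea is to look at the coefficients of f multiplied by a cut-off, and
    to play the two ends of the resulting Fourier series against each other.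

    Take a bump with support in I and absolutely summable Fourier coefficients
    ([bump_coef]; a parabola is enough), and let c be the Fourier coefficients of
    the product of the bump with the boundary values of f ([boundary_coef]). The
    bounded means say that c defines a bounded functional on trigonometric
    polynomials for the supremum norm ([boundary_functional_le]), that is, the
    product is a measure. As f has no negative powers, c tends to 0 at one end
    ([boundary_coef_pos]). Rajchman's theorem says that the Fourier coefficients
    of a complex measure which tend to 0 at one end tend to 0 at the other
    ([rajchman]), so c also tends to 0 in the direction of the large powers
    ([boundary_coef_neg]).

    Read around the index n_j, the coefficient c of index - n_j is the sum of the
    a_(n_j + k) weighted by the Fourier coefficients of the bump. The part k < 0
    tends to 0 by hypothesis and the far tails are uniformly small, so the
    polynomial w with coefficients a_(n_j + k) psi(k), 0 <= k < L, where psi stands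
    for [bump_coef], is small at the centre of the bump on the unit circle
    ([right_part_le]). The bump may be centred anywhere in a fixed subarc, hence w
    is small at any finitely many points of a subarc, and it is bounded on the
    whole circle. A polynomial with these properties has a small constant term,
    because the product of finitely many rotations of it is small at all points of
    a prescribed finite subgroup of the circle ([constant_term_le]). But the
    constant term of w is a_(n_j) times a nonzero constant, which does not tend
    to 0.

    Rajchman's theorem is proved for functionals, by a variational argument that
    involves no measure: if the trigonometric polynomial q, bounded by 1, almost
    attains the norm of the functional T, then perturbing q by
    t (be - conj be q^2), with be a unimodular multiple of the character e_(-n),
    raises the supremum norm by O(t^2) only ([tangent_perturbation]), so T(e_(-n))
    cannot exceed |T(q^2 e_n)| by more than O(t), and T(q^2 e_n) tends to 0 because
    q is fixed. *)

Import Order.TTheory GRing.Theory Num.Theory.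
Import numFieldNormedType.Exports.

Local Open Scope classical_set_scope.
Local Open Scope ring_scope.

Set Implicit Arguments.
Unset Strict Implicit.

(** * The complex modulus and convergence of complex series *)

Lemma normc_normr (R : realType) (z : R[i]) : `|z| = (normc z)%:C%C.
Proof. by rewrite normc_def; case: z. Qed.

Lemma normc_ge0 (R : realType) (z : R[i]) : 0 <= normc z.
Proof. by rewrite -ler0c -normc_normr. Qed.

Lemma normcD_le (R : realType) (x y : R[i]) :
  normc (x + y) <= normc x + normc y.
Proof. exact: le_normcD. Qed.

Lemma normc_opp (R : realType) (x : R[i]) : normc (- x) = normc x.
Proof. exact: normcN. Qed.

Lemma normc_distC (R : realType) (x y : R[i]) : normc (x - y) = normc (y - x).
Proof. by rewrite -normc_opp opprB. Qed.

Lemma normcB_le (R : realType) (x y : R[i]) :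
  normc (x - y) <= normc x + normc y.
Proof. by rewrite -(normc_opp y) normcD_le. Qed.

Local Notation normcM := ComplexField.Normc.normcM.
Local Notation normc0 := ComplexField.Normc.normc0.
Local Notation normc1 := ComplexField.Normc.normc1.

Lemma normcX_eq (R : realType) (x : R[i]) n : normc (x ^+ n) = normc x ^+ n.
Proof.
elim: n => [|n IH]; first by rewrite !expr0 normc1.
by rewrite !exprS normcM IH.
Qed.

Lemma normc_sum_le (R : realType) (I : Type) (s : seq I) (P : pred I)
    (F : I -> R[i]) :
  normc (\sum_(i <- s | P i) F i) <= \sum_(i <- s | P i) normc (F i).
Proof.
elim/big_ind2: _ => [|x1 x2 y1 y2 h1 h2|//]; first by rewrite normc0.
exact: le_trans (normcD_le _ _) (lerD h1 h2).
Qed.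

Lemma normcR (R : realType) (x : R) : normc (x%:C)%C = `|x|.
Proof. by rewrite /= expr0n addr0 sqrtr_sqr. Qed.

Lemma normc_conj (R : realType) (z : R[i]) : normc (z^*)%C = normc z.
Proof. by case: z => x y /=; rewrite sqrrN. Qed.

Lemma sqr_normcE (R : realType) (z : R[i]) :
  normc z ^+ 2 = complex.Re z ^+ 2 + complex.Im z ^+ 2.
Proof. by case: z => x y /=; rewrite sqr_sqrtr // addr_ge0 ?sqr_ge0. Qed.

Lemma Re_le_normc (R : realType) (z : R[i]) : complex.Re z <= normc z.
Proof.
rewrite (le_trans (ler_norm _)) // -sqrtr_sqr; case: z => x y /=.
by rewrite ler_wsqrtr // lerDl sqr_ge0.
Qed.

Lemma normRe_le_normc (R : realType) (z : R[i]) : `|complex.Re z| <= normc z.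
Proof.
by rewrite -sqrtr_sqr; case: z => x y /=; rewrite ler_wsqrtr // lerDl sqr_ge0.
Qed.

Lemma normIm_le_normc (R : realType) (z : R[i]) : `|complex.Im z| <= normc z.
Proof.
by rewrite -sqrtr_sqr; case: z => x y /=; rewrite ler_wsqrtr // lerDr sqr_ge0.
Qed.

Lemma normc_le_ReIm (R : realType) (z : R[i]) :
  normc z <= `|complex.Re z| + `|complex.Im z|.
Proof.
rewrite [leLHS](_ : _ = normc ((complex.Re z)%:C + 'i * (complex.Im z)%:C)%C);
  last by rewrite -complexE.
rewrite (le_trans (normcD_le _ _)) // normcM !normcR.
by rewrite [normc 'i%C](_ : _ = 1) ?mul1r //= expr0n expr1n add0r sqrtr1.
Qed.

(** This turns a bound on real parts, valid for all rotations of a quantity,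
    into a bound on its modulus. *)
Lemma normc_rotate (R : realType) (z : R[i]) :
  exists2 u : R[i], normc u = 1 & u * z = (normc z)%:C%C.
Proof.
have [->|z0] := eqVneq z 0.
  by exists 1; rewrite ?normc1 // mulr0 normc0.
have nz0 : normc z != 0.
  by apply: contra z0 => /eqP /ComplexField.Normc.eq0_normc ->.
exists ((normc z)%:C * z^-1)%C.
  rewrite normcM ComplexField.Normc.normcV normcR ger0_norm ?normc_ge0 //.
  by rewrite divff.
by rewrite mulfVK.
Qed.

(** Convergence in the complex plane is by definition tested with radii that are
    themselves complex; the positive ones are exactly the positive reals. *)
Lemma cvgc_normP (R : realType) (T : Type) (F : set_system T) (FF : Filter F)
    (f : T -> R[i]^o) (l : R[i]^o) :
  f x @[x --> F] --> l <->
  (forall e : R, 0 < e -> \forall x \near F, normc (f x - l) < e).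
Proof.
split=> [/cvgrPdist_lt h e e0|h].
  have e0' : (0 : R[i]) < e%:C%C by rewrite ltcR.
  apply: filterS (h _ e0') => x; rewrite normc_normr ltcR.
  by rewrite normc_distC.
apply/cvgrPdist_lt => e; rewrite ltcE => /andP[/eqP e1 e2].
apply: filterS (h (complex.Re e) e2) => x; rewrite normc_distC => hx.
by rewrite normc_normr ltcE /= e1 hx eqxx.
Qed.

Lemma ReD (R : realType) (x y : R[i]) :
  complex.Re (x + y) = complex.Re x + complex.Re y.
Proof. by case: x y => [? ?] [? ?]. Qed.

Lemma ImD (R : realType) (x y : R[i]) :
  complex.Im (x + y) = complex.Im x + complex.Im y.
Proof. by case: x y => [? ?] [? ?]. Qed.

Lemma Re_sum (R : realType) (I : Type) (s : seq I) (P : pred I)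
    (F : I -> R[i]) :
  complex.Re (\sum_(i <- s | P i) F i) = \sum_(i <- s | P i) complex.Re (F i).
Proof. by apply: (big_morph (@complex.Re R)) => // -[? ?] [? ?]. Qed.

Lemma Im_sum (R : realType) (I : Type) (s : seq I) (P : pred I)
    (F : I -> R[i]) :
  complex.Im (\sum_(i <- s | P i) F i) = \sum_(i <- s | P i) complex.Im (F i).
Proof. by apply: (big_morph (@complex.Im R)) => // -[? ?] [? ?]. Qed.

(** The real and imaginary parts are absolutely convergent real series. *)
Lemma cvg_series_normc (R : realType) (v : nat -> R[i]^o) (U : R) :
  (forall N, \sum_(0 <= n < N) normc (v n) <= U) -> cvgn (series v).
Proof.
move=> vU.
have real_part (g : R[i] -> R) : (forall z, `|g z| <= normc z) ->
    cvgn (series (g \o v)).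
  move=> gle; apply: normed_cvg; apply: nondecreasing_is_cvgn.
    apply/nondecreasing_seqP => n /=.
    by rewrite /series /= big_nat_recr //= lerDl.
  exists U => _ [N _ <-]; apply: le_trans (vU N).
  by rewrite /series /=; apply: ler_sum => i _; exact: gle.
have /cvg_ex[/= x hx] := real_part _ (@normRe_le_normc R).
have /cvg_ex[/= y hy] := real_part _ (@normIm_le_normc R).
apply/cvg_ex; exists (x +i* y)%C; apply/cvgc_normP => e e0.
have e2 : 0 < e / 2 by rewrite divr_gt0.
move/cvgrPdist_lt/(_ _ e2) : hx => hx; move/cvgrPdist_lt/(_ _ e2) : hy => hy.
near=> N.
apply: le_lt_trans (normc_le_ReIm _) _; rewrite [ltRHS](splitr e).
have -> : complex.Re (series v N - (x +i* y)%C)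
    = series (complex.Re (R := R) \o v) N - x.
  by rewrite raddfB /= /series /= Re_sum.
have -> : complex.Im (series v N - (x +i* y)%C)
    = series (complex.Im (R := R) \o v) N - y.
  by rewrite raddfB /= /series /= Im_sum.
by rewrite ltrD // distrC; near: N.
Unshelve. all: by end_near. Qed.

Lemma series_tail_le (R : realType) (v : nat -> R[i]^o) (K : nat) (W : R) :
  cvgn (series v) ->
  (forall M, (K <= M)%N -> \sum_(K <= n < M) normc (v n) <= W) ->
  normc (limn (series v) - \sum_(0 <= n < K) v n) <= W.
Proof.
move=> cv vW; apply/ler_addgt0Pr => e e0.
move/cvgc_normP : cv => /(_ _ e0) cv.
have [M [KM hM]] : exists M, (K <= M)%N /\
    normc (series v M - limn (series v)) < e.
  near \oo => M; exists M; split; near: M => //.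
  exact: nbhs_infty_ge.
have -> : limn (series v) - \sum_(0 <= n < K) v n =
    (\sum_(K <= n < M) v n) + (limn (series v) - series v M).
  rewrite /series /= [\sum_(0 <= k < M) _](@big_cat_nat _ _ _ K) //=.
  by rewrite opprD [RHS]addrCA [X in _ = _ + X]addrC subrK.
apply: le_trans (normcD_le _ _) _; rewrite lerD // ?(vW M) //; last first.
  by rewrite normc_distC ltW.
exact: le_trans (normc_sum_le _ _ _) (vW M KM).
Unshelve. all: by end_near. Qed.

(** * Power series with bounded coefficients *)

Lemma geometric_tail_le (R : realType) (x : R) (K M : nat) :
  0 <= x < 1 -> \sum_(K <= n < M) x ^+ n <= x ^+ K / (1 - x).
Proof.
move=> /andP[x0 x1]; have x1' : 0 < 1 - x by rewrite subr_gt0.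
case: (leqP K M) => [KM|MK]; last first.
  by rewrite big_geq ?(ltnW MK) // divr_ge0 ?exprn_ge0 // ltW.
rewrite ler_pdivlMr //.
have -> : (\sum_(K <= n < M) x ^+ n) * (1 - x) = x ^+ K - x ^+ M.
  elim: M KM => [|M IH].
    by rewrite leqn0 => /eqP ->; rewrite big_geq // mul0r subrr.
  rewrite leq_eqVlt => /orP[/eqP ->|]; first by rewrite big_geq // mul0r subrr.
  by rewrite ltnS => KM; rewrite big_nat_recr //= mulrDl IH // exprS; ring.
by rewrite lerBlDr lerDl exprn_ge0.
Qed.

(** Identities between sums of power series are proved by comparing partial sums
    and letting the error, geometric in the number of terms, tend to 0. *)
Lemma geometric_squeeze (R : realType) (rho D : R) (x : R[i]) :
  0 <= rho < 1 -> (forall K, normc x <= D * rho ^+ K) -> x = 0.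
Proof.
move=> /andP[r0 r1] xD; apply: ComplexField.Normc.eq0_normc.
apply/eqP; rewrite eq_le normc_ge0 andbT.
have cvg0 : (D * rho ^+ K) @[K --> \oo] --> (D * 0 : R).
  apply: cvgM; first exact: cvg_cst.
  by apply: cvg_expr; rewrite ger0_norm.
rewrite mulr0 in cvg0.
rewrite -(cvg_lim (@Rhausdorff _) cvg0).
apply: limr_ge; first by apply/cvg_ex; exists 0.
by apply: nearW.
Qed.

Section BoundedPowerSeries.
Context {R : realType}.
Implicit Types (a b : nat -> R[i]) (z w : R[i]^o) (A : R).

Lemma ps_abs_tail a A z (K M : nat) :
  (forall n, normc (a n) <= A) -> normc z < 1 ->
  \sum_(K <= n < M) normc (a n * z ^+ n) <= A * (normc z ^+ K / (1 - normc z)).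
Proof.
move=> aA z1; have A0 : 0 <= A := le_trans (normc_ge0 _) (aA 0).
apply: (@le_trans _ _ (A * \sum_(K <= n < M) normc z ^+ n)).
  rewrite mulr_sumr; apply: ler_sum => n _.
  by rewrite normcM normcX_eq ler_wpM2r ?exprn_ge0 ?normc_ge0.
by apply: ler_wpM2l => //; apply: geometric_tail_le; rewrite normc_ge0.
Qed.

Lemma ps_cvg a A z :
  (forall n, normc (a n) <= A) -> normc z < 1 ->
  cvgn (series (fun n => a n * z ^+ n : R[i]^o)).
Proof.
by move=> aA z1; apply: cvg_series_normc => N; exact: ps_abs_tail.
Qed.

Lemma ps_tail a A z (K : nat) :
  (forall n, normc (a n) <= A) -> normc z < 1 ->
  normc (power_series a z - \sum_(0 <= n < K) a n * z ^+ n) <=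
  A * (normc z ^+ K / (1 - normc z)).
Proof.
move=> aA z1; apply: series_tail_le; first exact: (ps_cvg aA).
by move=> M _; exact: ps_abs_tail.
Qed.

Lemma ps_bound a A z :
  (forall n, normc (a n) <= A) -> normc z < 1 ->
  normc (power_series a z) <= A / (1 - normc z).
Proof.
move=> aA z1; have := ps_tail 0 aA z1.
by rewrite big_geq // subr0 expr0 mul1r.
Qed.

Lemma ps_shift a A z :
  (forall n, normc (a n) <= A) -> normc z < 1 ->
  power_series a z = a 0%N + z * power_series (a \o S) z.
Proof.
move=> aA z1; apply/eqP; rewrite -subr_eq0; apply/eqP.
apply: (@geometric_squeeze _ (normc z) (A / (1 - normc z) * 2)) => [|K].
  by rewrite normc_ge0.
have t1 := ps_tail K.+1 aA z1.
have t2 : normc (power_series (a \o S) z - \sum_(0 <= n < K) a n.+1 * z ^+ n) <=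
  A * (normc z ^+ K / (1 - normc z)).
  by apply: (@ps_tail (a \o S)) => // n; exact: aA.
rewrite [X in normc X](_ : _ =
    (power_series a z - \sum_(0 <= n < K.+1) a n * z ^+ n)
    - z * (power_series (a \o S) z - \sum_(0 <= n < K) a n.+1 * z ^+ n)).
  apply: le_trans (normcB_le _ _) _; rewrite normcM.
  have x0 : 0 <= A * (normc z ^+ K / (1 - normc z)) := le_trans (normc_ge0 _) t2.
  have h1 : A * (normc z ^+ K.+1 / (1 - normc z)) <=
      A * (normc z ^+ K / (1 - normc z)).
    rewrite exprS -mulrA mulrCA -[leRHS]mul1r.
    by rewrite ler_wpM2r // ltW.
  have h2 : normc z * normc (power_series (a \o S) z -
      \sum_(0 <= n < K) a n.+1 * z ^+ n) <= A * (normc z ^+ K / (1 - normc z)).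
    by rewrite -[leRHS]mul1r ler_pM ?normc_ge0 // ltW.
  apply: le_trans (lerD (le_trans t1 h1) h2) _.
  by rewrite le_eqVlt; apply/orP; left; apply/eqP; ring.
rewrite big_nat_recl // expr0 mulr1.
have -> : \sum_(0 <= i < K) a i.+1 * z ^+ i.+1 =
    z * \sum_(0 <= i < K) a i.+1 * z ^+ i.
  by rewrite mulr_sumr; apply: eq_bigr => i _; rewrite exprS mulrCA.
by ring.
Qed.

(** Dividing f(w) - f(z) by w - z leaves a power series in w whose coefficients
    are the values at z of the shifted series; they are bounded again, so the
    quotient can be divided once more. *)
Lemma ps_quotient a A z :
  (forall n, normc (a n) <= A) -> normc z < 1 ->
  exists2 b, (forall n, normc (b n) <= A / (1 - normc z)) &
    forall w, normc w < 1 ->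
      power_series a w - power_series a z = (w - z) * power_series b w.
Proof.
move=> aA z1; pose B m : R[i]^o := power_series (fun n => a (m + n)%N) z.
have BA m : normc (B m) <= A / (1 - normc z).
  by apply: ps_bound => // n; exact: aA.
have Brec m : B m = a m + z * B m.+1.
  rewrite /B (@ps_shift _ A) //= addn0; congr (_ + _ * _).
  congr (power_series _ _).
  by apply/funext => n /=; rewrite addSnnS.
exists (fun m => B m.+1) => [n|w w1]; first exact: BA.
have A0 : 0 <= A := le_trans (normc_ge0 _) (aA 0%N).
have tele N : (w - z) * \sum_(0 <= m < N) B m.+1 * w ^+ m =
    \sum_(0 <= m < N) a m * w ^+ m + B N * w ^+ N - B 0%N.
  elim: N => [|N IH].
    by rewrite !big_geq // expr0 mulr0 mulr1 add0r subrr.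
  rewrite !big_nat_recr //= mulrDr IH (Brec N) exprS.
  by ring.
apply/eqP; rewrite -subr_eq0; apply/eqP.
pose C := A / (1 - normc z).
apply: (@geometric_squeeze _ (normc w)
    (A / (1 - normc w) + normc (w - z) * (C / (1 - normc w)) + C)) => [|K].
  by rewrite normc_ge0.
have t1 := ps_tail K aA w1.
have t2 : normc (power_series (fun m => B m.+1) w -
    \sum_(0 <= m < K) B m.+1 * w ^+ m) <= C * (normc w ^+ K / (1 - normc w)).
  by apply: ps_tail => // n; exact: BA.
have -> : power_series a w - power_series a z -
      (w - z) * power_series (fun m => B m.+1) w =
    (power_series a w - \sum_(0 <= m < K) a m * w ^+ m)
    - (w - z) * (power_series (fun m => B m.+1) w -
      \sum_(0 <= m < K) B m.+1 * w ^+ m) - B K * w ^+ K.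
  rewrite mulrBr tele.
  have -> : power_series a z = B 0%N by [].
  by ring.
apply: le_trans (normcB_le _ _) _.
rewrite [leRHS]mulrDl [X in _ <= X + _]mulrDl lerD //; last first.
  by rewrite normcM normcX_eq ler_wpM2r ?exprn_ge0 ?normc_ge0 ?BA.
apply: le_trans (normcB_le _ _) _; rewrite lerD //.
  by rewrite mulrAC -mulrA.
rewrite normcM -mulrA ler_wpM2l ?normc_ge0 //.
by rewrite mulrAC -mulrA.
Qed.

Lemma ps_lipschitz a A z w (rho : R) :
  (forall n, normc (a n) <= A) -> rho < 1 ->
  normc z <= rho -> normc w <= rho ->
  normc (power_series a w - power_series a z) <=
  normc (w - z) * (A / (1 - rho) / (1 - rho)).
Proof.
move=> aA r1 zr wr.
have z1 := le_lt_trans zr r1; have w1 := le_lt_trans wr r1.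
have A0 : 0 <= A := le_trans (normc_ge0 _) (aA 0%N).
have [b bA ->//] := ps_quotient aA z1.
rewrite normcM ler_wpM2l ?normc_ge0 //.
apply: le_trans (ps_bound bA w1) _.
have inv x : x <= rho -> (1 - x)^-1 <= (1 - rho)^-1.
  move=> xr; have ? : 0 < 1 - rho by rewrite subr_gt0.
  have hx : 1 - rho <= 1 - x by rewrite lerD2l lerN2.
  by rewrite lef_pV2 ?posrE // (lt_le_trans _ hx).
have inv0 x : x < 1 -> 0 <= (1 - x)^-1 by move=> x1; rewrite invr_ge0 subr_ge0 ltW.
apply: ler_pM; [apply: mulr_ge0 => //; exact: inv0|exact: inv0| |exact: inv].
by apply: ler_wpM2l => //; exact: inv.
Qed.

(** Two divisions give f(w) = f(z) + (w - z) (g(z) + (w - z) k(w)) with k bounded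
    near z, which is differentiability with derivative g(z). *)
Lemma ps_analytic a A :
  (forall n, normc (a n) <= A) -> analytic_on (@unit_disk R) (power_series a).
Proof.
move=> aA z z1; rewrite /unit_disk /= in z1.
have [b bA fb] := ps_quotient aA z1; have [d dA fd] := ps_quotient bA z1.
apply/cvg_ex; exists (power_series b z : R[i]^o); apply/cvgc_normP => e e0.
(* the factor k is bounded on the disk of radius [rho] *)
pose rho := (1 + normc z) / 2.
have zr : normc z < rho by rewrite /rho; lra.
have r1 : rho < 1 by rewrite /rho; lra.
pose D := A / (1 - normc z) / (1 - normc z).
have D0 : 0 <= D := le_trans (normc_ge0 _) (dA 0%N).
have dlt : 0 < Num.min (rho - normc z) (e * (1 - rho) / (D + 1)).
  rewrite lt_min subr_gt0 zr /= divr_gt0 ?ltr_wpDl // mulr_gt0 // subr_gt0 //.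
have hnear : \forall h \near (0 : R[i]^o)^',
    normc h < Num.min (rho - normc z) (e * (1 - rho) / (D + 1)).
  have : (id x : R[i]^o) @[x --> (0 : R[i]^o)^'] --> (0 : R[i]^o).
    exact: cvg_within.
  by move/cvgc_normP/(_ _ dlt); apply: filterS => h; rewrite subr0.
have hne : \forall h \near (0 : R[i]^o)^', h != 0 by exact: nbhs_dnbhs_neq.
apply: filterS2 hnear hne => h; rewrite lt_min => /andP[h1 h2] h0 /=.
have hz : (h *: (1 : R[i]^o) + z : R[i]^o) = h + z by rewrite /GRing.scale /= mulr1.
have whr : normc (h + z) < rho.
  by apply: le_lt_trans (normcD_le _ _) _; rewrite -ltrBrDr.
have wh1 := lt_trans whr r1.
rewrite /GRing.scale /= mulr1 (fb _ wh1) addrK mulKf //.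
rewrite (fd _ wh1) addrK normcM.
have bd : normc (power_series d (h + z)) <= D / (1 - rho).
  apply: le_trans (ps_bound dA wh1) _.
  have ? : 0 < 1 - rho by rewrite subr_gt0.
  have hx : 1 - rho <= 1 - normc (h + z) by rewrite lerD2l lerN2 ltW.
  by rewrite ler_wpM2l // lef_pV2 ?posrE // (lt_le_trans _ hx).
apply: le_lt_trans (ler_wpM2l (normc_ge0 _) bd) _.
have r1' : 0 < 1 - rho by rewrite subr_gt0.
rewrite mulrA ltr_pdivrMr //.
move: h2; rewrite ltr_pdivlMr ?ltr_wpDl // => h2.
by apply: le_lt_trans h2; rewrite ler_wpM2l ?normc_ge0 // lerDl.
Qed.

End BoundedPowerSeries.

(** * Trigonometric polynomials and one-sided decay of Fourier coefficients *)

Section Expi.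
Context {R : realType}.
Implicit Types s t : R.

Lemma expiD s t : expi (s + t) = expi s * expi t.
Proof.
by apply/eqP; rewrite eq_complex /= cosD sinD [X in _ && (X == _)]addrC !eqxx.
Qed.

Lemma expi0 : expi (0 : R) = 1.
Proof. by rewrite /expi cos0 sin0. Qed.

Lemma normc_expi t : normc (expi t) = 1.
Proof. by rewrite /expi /= cos2Dsin2 sqrtr1. Qed.

Lemma conj_expi t : ((expi t)^*)%C = expi (- t).
Proof. by rewrite /expi /= cosN sinN. Qed.

Lemma expiX t n : expi t ^+ n = expi (n%:R * t).
Proof.
elim: n => [|n IH]; first by rewrite expr0 mul0r expi0.
by rewrite exprS IH -expiD -{1}[t]mul1r -mulrDl -natr1 addrC.
Qed.

Lemma expi_period t (k : int) : expi (t + k%:~R * (2 * pi)) = expi t.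
Proof.
have e1 : expi (2 * pi : R) = 1.
  by rewrite /expi mulrC [_ * 2]mulr_natr cos2pi sin2pi.
have en n : expi (n%:R * (2 * pi) : R) = 1 by rewrite -expiX e1 expr1n.
rewrite expiD; case: k => n; first by rewrite en mulr1.
by rewrite NegzE mulrNz mulNr -conj_expi en conjc1 mulr1.
Qed.

End Expi.

(** A trigonometric polynomial is kept as the list of its terms, so that a
    linear functional is given by its values [c k] on the characters, without any
    question of well-definedness on functions. *)
Definition trig_apply (R : realType) (c : int -> R[i]) (p : seq (R[i] * int))
    : R[i] := \sum_(x <- p) x.1 * c x.2.

Definition trig_eval (R : realType) (p : seq (R[i] * int)) (t : R) : R[i] :=
  trig_apply (fun k => expi (k%:~R * t)) p.

Definition trig_scale (R : realType) (al : R[i]) (p : seq (R[i] * int)) :=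
  [seq (al * x.1, x.2) | x <- p].

Definition trig_shift (R : realType) (n : int) (p : seq (R[i] * int)) :=
  [seq (x.1, x.2 + n) | x <- p].

Definition trig_sqr (R : realType) (p : seq (R[i] * int)) :=
  [seq (x.1 * y.1, x.2 + y.2) | x <- p, y <- p].

Section TrigPoly.
Context {R : realType}.
Implicit Types (p q : seq (R[i] * int)) (c : int -> R[i]) (t : R).

Lemma trig_apply_cat c p q :
  trig_apply c (p ++ q) = trig_apply c p + trig_apply c q.
Proof. by rewrite /trig_apply big_cat. Qed.

Lemma trig_apply_seq1 c x k : trig_apply c [:: (x, k)] = x * c k.
Proof. by rewrite /trig_apply big_seq1. Qed.

Lemma trig_apply_cons c x k p :
  trig_apply c ((x, k) :: p) = x * c k + trig_apply c p.
Proof. by rewrite /trig_apply big_cons. Qed.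

Lemma trig_apply_scale c al p :
  trig_apply c (trig_scale al p) = al * trig_apply c p.
Proof.
rewrite /trig_apply big_map mulr_sumr; apply: eq_bigr => x _.
by rewrite mulrA.
Qed.

Lemma trig_eval_shift n p t :
  trig_eval (trig_shift n p) t = trig_eval p t * expi (n%:~R * t).
Proof.
rewrite /trig_eval /trig_apply big_map mulr_suml; apply: eq_bigr => x _ /=.
by rewrite -mulrA -expiD -mulrDl -intrD.
Qed.

Lemma trig_eval_sqr p t : trig_eval (trig_sqr p) t = trig_eval p t ^+ 2.
Proof.
rewrite /trig_eval /trig_apply big_allpairs_dep expr2 mulr_suml.
apply: eq_bigr => x _; rewrite mulr_sumr; apply: eq_bigr => y _ /=.
by rewrite intrD mulrDl expiD mulrACA.
Qed.

(** The functional loses any fixed trigonometric polynomial when the latter is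
    moved far enough in the direction in which its values decay. *)
Lemma trig_apply_shift_small c p (e : R) :
  (forall e : R, 0 < e -> \forall n \near \oo, normc (c n%:Z) < e) ->
  0 < e -> \forall n \near \oo, normc (trig_apply c (trig_shift n%:Z p)) < e.
Proof.
move=> c0; elim: p e => [|[x k] p IH] e e0.
  by apply: nearW => n; rewrite /trig_apply big_nil normc0.
have e2 : 0 < e / 2 by rewrite divr_gt0.
have ex : 0 < e / 2 / (normc x + 1) by rewrite divr_gt0 // ltr_wpDl ?normc_ge0.
have := c0 _ ex => -[N _ hN].
near=> n.
rewrite /trig_apply /= big_cons /=; apply: le_lt_trans (normcD_le _ _) _.
rewrite [ltRHS](splitr e) ltrD //; last by near: n; exact: IH.
have [m [Nm ->]] : exists m : nat, (N <= m)%N /\ k + n%:Z = m%:Z.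
  have hn : (N + absz k <= n)%N by near: n; exact: nbhs_infty_ge.
  by exists (absz (k + n%:Z)); lia.
rewrite normcM; apply: le_lt_trans (_ : _ <= normc x * _) _.
  by apply: ler_wpM2l; [exact: normc_ge0 | exact: ltW (hN m Nm)].
by rewrite mulrA ltr_pdivrMr ?ltr_wpDl ?normc_ge0 // mulrC ltr_pM2l // ltrDl.
Unshelve. all: by end_near. Qed.

(** The perturbation [be - conj be * q ^+ 2] is tangent to the unit circle at
    every unimodular [q], so it changes the modulus only to second order there.
    Inside the disk its radial part is at most twice the distance from [q] to the
    circle, so that [t <= 1 / 2] keeps the first order change inside the disk. *)
Lemma tangent_perturbation (q be : R[i]) (t : R) :
  normc q <= 1 -> normc be = 1 -> 0 <= t <= 1 / 2 ->
  normc (q + (t%:C)%C * (be - (be^*)%C * q ^+ 2)) <= 1 + 2 * t ^+ 2.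
Proof.
move=> q1 b1 /andP[t0 t1].
have q2 : normc q ^+ 2 <= 1 by rewrite expr_le1 ?normc_ge0.
have b2 : normc be ^+ 2 = 1 by rewrite b1 expr1n.
rewrite -(@ler_pXn2r _ 2) ?nnegrE ?normc_ge0 ?addr_ge0 ?mulr_ge0 ?sqr_ge0 //.
apply: (@le_trans _ _ (1 + 4 * t ^+ 2)); last first.
  by have := sqr_ge0 (t ^+ 2); nra.
move: q2 b2; rewrite !sqr_normcE.
case: q q1 => x y _ /=; case: be b1 => u v _ /=.
set s := x ^+ 2 + y ^+ 2 => s1 uv.
have s0 : 0 <= s by rewrite addr_ge0 ?sqr_ge0.
have cs : (x * u + y * v) ^+ 2 <= 1.
  have -> : (x * u + y * v) ^+ 2 = s * (u ^+ 2 + v ^+ 2) - (x * v - y * u) ^+ 2.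
    by rewrite /s; ring.
  by rewrite uv mulr1; have := sqr_ge0 (x * v - y * u); lra.
have cs1 : x * u + y * v <= 1 by nra.
rewrite expr2 /=.
rewrite [leLHS](_ : _ = s + 2 * t * (x * u + y * v) * (1 - s)
  + t ^+ 2 * ((u ^+ 2 + v ^+ 2) * (1 + s) ^+ 2
              - 4 * (x * u + y * v) ^+ 2)); last first.
  by rewrite /s; ring.
rewrite uv mul1r.
have t2 := sqr_ge0 t; have w2 := sqr_ge0 (x * u + y * v).
have h1 : 2 * t * (x * u + y * v) * (1 - s) <= 1 - s.
  rewrite -[leRHS]mul1r ler_wpM2r ?subr_ge0 //; nra.
have h2 : (1 + s) ^+ 2 <= 4 by nra.
nra.
Qed.

(** Let M be the norm of the functional and q almost extremal, up to [t ^+ 2].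
    Testing the functional on q + t (al e_(-n) - conj al q^2 e_n), which is at
    most 1 + 2 t^2 in modulus, and rotating so that al T(e_(-n)) = |T(e_(-n))|,
    gives |T(e_(-n))| <= |T(q^2 e_n)| + O(t). Here q depends on t but not on n, so
    the first term on the right tends to 0 with n. *)
Theorem rajchman c (B : R) :
  (forall p, (forall t, normc (trig_eval p t) <= 1) ->
     normc (trig_apply c p) <= B) ->
  (forall e : R, 0 < e -> \forall n \near \oo, normc (c n%:Z) < e) ->
  forall e : R, 0 < e -> \forall n \near \oo, normc (c (- n%:Z)) < e.
Proof.
move=> cB c0 e e0.
pose unit_ball p := forall t, normc (trig_eval p t) <= 1.
pose V := [set complex.Re (trig_apply c p) | p in unit_ball].
have ub0 : unit_ball [::].
  by move=> t; rewrite /trig_eval /trig_apply big_nil normc0.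
have supV : has_sup V.
  split; first by exists (complex.Re (trig_apply c [::])); exists [::].
  by exists B => _ [p pu <-]; exact: le_trans (Re_le_normc _) (cB _ pu).
pose M := sup V.
have M0 : 0 <= M.
  have : V 0 by exists [::] => //; rewrite /trig_apply big_nil.
  by apply: ub_le_sup; case: supV.
(* homogeneity: the norm also controls trigonometric polynomials bounded by [la] *)
have supM p (la : R) : 0 < la -> (forall t, normc (trig_eval p t) <= la) ->
    complex.Re (trig_apply c p) <= M * la.
  move=> la0 pla.
  have : V (complex.Re (trig_apply c (trig_scale (la^-1)%:C%C p))).
    exists (trig_scale (la^-1)%:C%C p) => // t.
    rewrite /trig_eval trig_apply_scale normcM normcR gtr0_norm ?invr_gt0 //.
    by rewrite mulrC ler_pdivrMr // mul1r; exact: pla.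
  move/(ub_le_sup (proj2 supV)); rewrite trig_apply_scale -/M => h.
  rewrite -ler_pdivrMr // mulrC; apply: le_trans h.
  by case: (trig_apply c p) => x y /=; rewrite mul0r subr0.
(* the bound obtained below is [t * (2 + 2 * M)]; [t] is chosen accordingly *)
pose t := Num.min (1 / 2) (e / (2 * (2 + 2 * M))).
have M2 : 0 < 2 + 2 * M by lra.
have t0 : 0 < t by rewrite lt_min divr_gt0 // divr_gt0 // mulr_gt0.
have t2 : t <= 1 / 2 by rewrite ge_min lexx.
have te : t * (2 + 2 * M) <= e / 2.
  rewrite -ler_pdivlMr // -[X in _ <= X]mulrA -invfM.
  by rewrite ge_min lexx orbT.
have tt0 : 0 < t ^+ 2 by rewrite exprn_gt0.
have [_ [q qu <-] qM] := sup_adherent tt0 supV.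
have := trig_apply_shift_small (trig_sqr q) c0 t0.
apply: filterS => n small.
have [al al1 alc] := normc_rotate (c (- n%:Z)).
pose p := q ++ trig_scale (t%:C)%C
  ([:: (al, - n%:Z)] ++ trig_scale (- (al^*)%C) (trig_shift n%:Z (trig_sqr q))).
have pE th : trig_eval p th = trig_eval q th + (t%:C)%C *
    (al * expi (- n%:R * th) - (((al * expi (- n%:R * th))^*)%C
       * trig_eval q th ^+ 2)).
  rewrite /p /trig_eval trig_apply_cat trig_apply_scale trig_apply_cat.
  rewrite trig_apply_seq1 trig_apply_scale -!/(trig_eval _ _).
  have -> : ((al * expi (- n%:R * th))^*)%C = (al^*)%C * expi (n%:R * th).
    by rewrite -[n%:R * th]opprK -mulNr -conj_expi -[LHS]/(conjc _) rmorphM.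
  rewrite trig_eval_shift trig_eval_sqr mulrNz.
  by ring.
have pbound th : normc (trig_eval p th) <= 1 + 2 * t ^+ 2.
  rewrite pE; apply: tangent_perturbation; [exact: qu| |by rewrite ltW].
  by rewrite normcM al1 normc_expi mulr1.
have := supM _ _ (ltr_wpDr (mulr_ge0 (ler0n _ _) (sqr_ge0 t)) ltr01) pbound.
rewrite /p trig_apply_cat trig_apply_scale trig_apply_cat trig_apply_seq1 alc.
rewrite trig_apply_scale.
set y := trig_apply c (trig_shift _ _) in small *.
rewrite raddfD /=.
have Rey : complex.Re (- (al^*)%C * y) >= - t.
  rewrite mulNr raddfN /= lerN2; apply: le_trans (Re_le_normc _) _.
  by rewrite normcM normc_conj al1 mul1r ltW.
have -> : complex.Re ((t%:C)%C * ((normc (c (- n%:Z)))%:C + - (al^*) * y)%C)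
   = t * (normc (c (- n%:Z)) + complex.Re (- (al^*)%C * y)).
  by case: (- _ * y) => y1 y2 /=; rewrite mul0r subr0.
move: Rey; set r1 := complex.Re _ => Rey.
move: qM; rewrite -/M; set r2 := complex.Re _ => qM.
set nc := normc _ => main.
have : t * nc <= t * (t * (2 + 2 * M)) by nra.
rewrite ler_pM2l // => h; apply: le_lt_trans (le_trans h te) _.
by rewrite ltr_pdivrMr // ltr_pMr // ltr1n.
Qed.

End TrigPoly.

(** * A bump with explicit Fourier coefficients *)

(** Only the values on |th - om| <= h matter. A polynomial cut off at two zeros
    has no jump, so its Fourier coefficients decay quadratically; for a parabola
    they have a short closed form. *)
Definition bump (R : realType) (h om th : R) : R := h ^+ 2 - (th - om) ^+ 2.

Definition bump_coef (R : realType) (h : R) (k : int) : R :=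
  if k == 0 then 4 / 3 * h ^+ 3
  else - 4 * h * cos (k%:~R * h) / k%:~R ^+ 2
       + 4 * sin (k%:~R * h) / k%:~R ^+ 3.

(** The integral of [bump h om th * expi (k * th)] over |th - om| <= h. *)
Definition bump_fourier (R : realType) (h om : R) (k : int) : R[i] :=
  expi (k%:~R * om) * ((bump_coef h k)%:C)%C.

Section Bump.
Context {R : realType}.
Implicit Types (h om : R) (x : R[i]) (k : int) (p : seq (R[i] * int)).

Lemma Re_mul_expi x (t : R) :
  complex.Re (x * expi t) = complex.Re x * cos t - complex.Im x * sin t.
Proof. by case: x. Qed.

Lemma Im_mul_expi x (t : R) :
  complex.Im (x * expi t) = complex.Re x * sin t + complex.Im x * cos t.
Proof. by case: x. Qed.

(** The primitive is explicit, so that the closed form of [bump_fourier] is its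
    variation over the support of the bump. *)
Lemma bump_term_primitive h om x k : exists G : R -> R,
  (forall th : R, is_derive th (1 : R) G
     (bump h om th * complex.Re (x * expi (k%:~R * th)))) /\
  G (om + h) - G (om - h) = complex.Re (x * bump_fourier h om k).
Proof.
have [->|k0] := eqVneq k 0.
  exists (fun th => complex.Re x * (h ^+ 2 * (th - om) - (th - om) ^+ 3 / 3)).
  split=> [th|].
    rewrite mul0r expi0 mulr1 /bump; apply: is_derive_eq.
    by rewrite /GRing.scale /=; field.
  rewrite /bump_fourier mul0r expi0 mul1r /bump_coef eqxx.
  by case: x => u v /=; field.
pose K : R := k%:~R; have K0 : K != 0 by rewrite intr_eq0.
pose A t := complex.Re x * cos (K * t) - complex.Im x * sin (K * t).
pose B t := complex.Re x * sin (K * t) + complex.Im x * cos (K * t).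
have dK (t : R) : is_derive t (1 : R) (fun t => K * t) K.
  by apply: is_derive_eq; rewrite /GRing.scale /=; ring.
have dcos (t : R) : is_derive t (1 : R) (fun t => cos (K * t)) (- K * sin (K * t)).
  by apply: is_derive_eq; rewrite /GRing.scale /=; ring.
have dsin (t : R) : is_derive t (1 : R) (fun t => sin (K * t)) (K * cos (K * t)).
  by apply: is_derive_eq; rewrite /GRing.scale /=; ring.
have dA (t : R) : is_derive t (1 : R) A (- K * B t).
  by rewrite /A /B; apply: is_derive_eq; rewrite /GRing.scale /=; ring.
have dB (t : R) : is_derive t (1 : R) B (K * A t).
  by rewrite /A /B; apply: is_derive_eq; rewrite /GRing.scale /=; ring.
(* repeated integration by parts; [A] and [B] are the real and imaginary
   parts of [x * expi (K * t)] *)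
exists (fun t => (h ^+ 2 - (t - om) ^+ 2) * B t / K
                 - 2 * (t - om) * A t / K ^+ 2 + 2 * B t / K ^+ 3).
split=> [th|].
  rewrite Re_mul_expi -/K -/(A th) /bump; apply: is_derive_eq.
  by rewrite /GRing.scale /=; field.
rewrite /bump_fourier /bump_coef (negPf k0) -/K mulrA.
rewrite [RHS](_ : _ = complex.Re (x * expi (K * om)) *
   (- 4 * h * cos (K * h) / K ^+ 2 + 4 * sin (K * h) / K ^+ 3)); last first.
  by case: (x * _) => u v /=; ring.
rewrite Re_mul_expi /A /B !mulrDr !mulrN !(cosD, sinD, cosN, sinN).
by field.
Qed.

Lemma bump_primitive h om p : exists G : R -> R,
  (forall th : R, is_derive th (1 : R) G
     (bump h om th * complex.Re (trig_eval p th))) /\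
  G (om + h) - G (om - h) = complex.Re (trig_apply (bump_fourier h om) p).
Proof.
elim: p => [|[x k] p [G [dG GE]]].
  exists (fun _ => 0); split=> [th|]; last first.
    by rewrite /trig_apply big_nil subrr.
  by rewrite /trig_eval /trig_apply big_nil mulr0; exact: is_derive_cst.
have [H [dH HE]] := bump_term_primitive h om x k.
exists (H + G); split=> [th|].
  rewrite /trig_eval trig_apply_cons ReD mulrDr.
  exact: is_deriveD.
rewrite trig_apply_cons ReD -GE -HE.
by rewrite -![(H + G) _]/(H _ + G _); ring.
Qed.

Lemma continuous_normc (f : R -> R[i]) :
  continuous (complex.Re (R := R) \o f) -> continuous (complex.Im (R := R) \o f) ->
  continuous (fun t => normc (f t)).
Proof.
move=> cRe cIm t.
have -> : (fun t => normc (f t)) =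
    (fun t => Num.sqrt ((complex.Re (f t)) ^+ 2 + (complex.Im (f t)) ^+ 2)).
  by apply/funext => s; case: (f s).
apply: continuous_cvg; first exact: sqrt_continuous.
by apply: cvgD; rewrite !expr2; apply: cvgM; (exact: cRe || exact: cIm).
Qed.

Lemma continuous_trig_eval p :
  continuous (complex.Re (R := R) \o trig_eval p) /\
  continuous (complex.Im (R := R) \o trig_eval p).
Proof.
have ck (f : R -> R) (k : int) : continuous f ->
      continuous (fun t : R => f (k%:~R * t)).
  move=> cf t; apply: (@continuous_comp _ _ _ (fun t : R => k%:~R * t) f).
    exact: mulrl_continuous.
  exact: cf.
elim: p => [|[x k] p [IHr IHi]].
  split=> t; rewrite /trig_eval /trig_apply.
    under eq_fun do rewrite /= big_nil; exact: cvg_cst.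
  under eq_fun do rewrite /= big_nil; exact: cvg_cst.
split=> t.
  have -> : complex.Re (R := R) \o trig_eval ((x, k) :: p) =
      (fun s => complex.Re x * cos (k%:~R * s) - complex.Im x * sin (k%:~R * s)
                + complex.Re (trig_eval p s)).
    by apply/funext => s /=; rewrite /trig_eval trig_apply_cons ReD Re_mul_expi.
  apply: cvgD; last exact: IHr.
  apply: cvgB; (apply: cvgM; first exact: cvg_cst); apply: ck.
    exact: continuous_cos.
  exact: continuous_sin.
have -> : complex.Im (R := R) \o trig_eval ((x, k) :: p) =
    (fun s => complex.Re x * sin (k%:~R * s) + complex.Im x * cos (k%:~R * s)
              + complex.Im (trig_eval p s)).
  by apply/funext => s /=; rewrite /trig_eval trig_apply_cons ImD Im_mul_expi.
apply: cvgD; last exact: IHi.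
apply: cvgD; (apply: cvgM; first exact: cvg_cst); apply: ck.
  exact: continuous_sin.
exact: continuous_cos.
Qed.

(** After rotating [p] so that the functional takes a real value on it, that value
    is the integral of the bump times the real part of [p], and the bump is at most
    [h ^+ 2]. *)
Lemma bump_functional_le h om p : 0 < h ->
  ((normc (trig_apply (bump_fourier h om) p))%:E <=
   \int[lebesgue_measure]_(t in `[(om - h)%R, (om + h)%R])
     ((h ^+ 2 * normc (trig_eval p t))%R)%:E)%E.
Proof.
move=> h0.
have [u u1 uE] := normc_rotate (trig_apply (bump_fourier h om) p).
have [G [dG GE]] := bump_primitive h om (trig_scale u p).
rewrite trig_apply_scale uE /= in GE.
have ab : om - h < om + h by lra.
have dG1 t : derivable G t (1 : R) by case: (dG t).
have cG t : {for t, continuous G}.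
  by apply: differentiable_continuous; exact/derivable1_diffP.
pose f t : R := bump h om t * complex.Re (trig_eval (trig_scale u p) t).
have cbump : continuous (bump h om).
  move=> t; apply: cvgB; first exact: cvg_cst.
  rewrite expr2; under eq_fun do rewrite expr2.
  by apply: cvgM; (apply: cvgB; [exact: cvg_id|exact: cvg_cst]).
have cf : continuous f.
  move=> t; apply: cvgM; first exact: cbump.
  by have [+ _] := continuous_trig_eval (trig_scale u p); apply.
have cp : continuous (fun t : R => h ^+ 2 * normc (trig_eval p t)).
  move=> t; apply: cvgM; first exact: cvg_cst.
  by apply: continuous_normc; case: (continuous_trig_eval p).
have := @continuous_FTC2 R f G _ _ ab.
rewrite -EFinB GE => <-; first last.
- by move=> t _; rewrite derive1E; case: (dG t).
- split; first by move=> t _; exact: dG1.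
  + exact/cvg_at_right_filter/cG.
  + exact/cvg_at_left_filter/cG.
- exact: continuous_subspaceT.
apply: le_integral => //.
- apply: continuous_compact_integrable; first exact: segment_compact.
  exact: continuous_subspaceT.
- apply: continuous_compact_integrable; first exact: segment_compact.
  exact: continuous_subspaceT.
move=> t; rewrite inE /= in_itv /= => /andP[t1 t2]; rewrite lee_fin /f.
have b0 : 0 <= bump h om t by rewrite /bump; nra.
have b1 : bump h om t <= h ^+ 2 by rewrite /bump lerBlDr lerDl sqr_ge0.
apply: le_trans (_ : _ <= bump h om t * normc (trig_eval p t)) _.
  rewrite ler_wpM2l // /trig_eval trig_apply_scale.
  by apply: le_trans (Re_le_normc _) _; rewrite normcM u1 mul1r.
by rewrite ler_wpM2r ?normc_ge0.
Qed.

End Bump.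

(** * Arcs and means over arcs *)

Section Arcs.
Context {R : realType}.
Implicit Types (I : set R[i]) (s t x y r A B : R) (a : nat -> R[i]).

(** If [expi s = expi t] with s in the open interval defining the arc, then t' near
    t is matched by [s + (t' - t)], still in that interval. *)
Lemma open_expi_preimage I : open_arc I -> open [set t | I (expi t)].
Proof.
case=> x [y [xy ->]]; rewrite openE => t /= [s + st].
rewrite in_itv /= => /andP[xs sy].
have d0 : 0 < Num.min (s - x) (y - s) by rewrite lt_min !subr_gt0 xs.
apply/nbhs_ballP; exists (Num.min (s - x) (y - s)) => //= t'.
rewrite /ball /= lt_min !ltr_distlC => /andP[/andP[h1 h2] /andP[h3 h4]].
exists (s + (t' - t)); first by rewrite in_itv /=; apply/andP; split; lra.
by rewrite expiD st -expiD addrC subrK.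
Qed.

Lemma measurable_arc_angles I : open_arc I -> measurable (arc_angles I).
Proof.
move=> Io.
have -> : arc_angles I = `[0, 2 * pi[%classic `&` [set t | I (expi t)].
  by apply/seteqP; split=> t; rewrite /arc_angles /= in_itv.
by apply: measurableI => //; exact: open_measurable (open_expi_preimage Io).
Qed.

(** The angle of the midpoint of the arc is reduced modulo 2 pi, and the segment
    extends to its right only, so that it does not wrap around at 0. *)
Lemma arc_angles_segment I : open_arc I ->
  exists x y, x < y /\ `[x, y]%classic `<=` arc_angles I.
Proof.
case=> a [b [ab ->]].
have pi0 : 0 < 2 * pi :> R by rewrite mulr_gt0 ?pi_gt0.
pose m := (a + b) / 2; pose k := Num.floor (m / (2 * pi)).
pose u := m - k%:~R * (2 * pi).
have u0 : 0 <= u by rewrite subr_ge0 -ler_pdivlMr // floor_le.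
have u1 : u < 2 * pi.
  have := floorD1_gt (m / (2 * pi)).
  by rewrite ltr_pdivrMr // intrD mulrDl mul1r /u -/k; lra.
pose d := Num.min ((b - a) / 2) (2 * pi - u).
have d0 : 0 < d by rewrite lt_min subr_gt0 u1 divr_gt0 // subr_gt0.
have d1 : d <= (b - a) / 2 by rewrite ge_min lexx.
have d2 : d <= 2 * pi - u by rewrite ge_min lexx orbT.
exists u, (u + d / 2); split; first by lra.
move=> t; rewrite /= in_itv /= => /andP[t1 t2]; split; first by lra.
exists (t + k%:~R * (2 * pi)); last exact: expi_period.
rewrite /= in_itv /=; move: t1 t2; rewrite /u /m; set z := _ * (2 * pi).
by move=> t1 t2; apply/andP; split; lra.
Qed.

Lemma continuous_ps_circle a A r :
  (forall n, normc (a n) <= A) -> 0 < r < 1 ->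
  continuous (fun t : R => normc (power_series a ((r%:C)%C * expi t))).
Proof.
move=> aA /andP[r0 r1] t.
have rE s : normc ((r%:C)%C * expi s) = r.
  by rewrite normcM normcR normc_expi mulr1 gtr0_norm.
pose D := A / (1 - r) / (1 - r).
have D0 : 0 <= D.
  have A0 : 0 <= A := le_trans (normc_ge0 _) (aA 0%N).
  by rewrite !divr_ge0 ?subr_ge0 // ltW.
apply/cvgrPdist_lt => e e0.
have [ccos csin] := (@continuous_cos R t, @continuous_sin R t).
have e2 : 0 < e / (D + 1) / 2 by rewrite !divr_gt0 // ltr_wpDl.
move/cvgrPdist_lt/(_ _ e2) : ccos => ccos.
move/cvgrPdist_lt/(_ _ e2) : csin => csin.
apply: filterS2 ccos csin => s h1 h2.
have h3 : normc (expi t - expi s) < e / (D + 1).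
  apply: le_lt_trans (normc_le_ReIm _) _.
  by rewrite [ltRHS]splitr ltrD.
have h4 : normc (power_series a ((r%:C)%C * expi t)
                 - power_series a ((r%:C)%C * expi s)) < e.
  apply: le_lt_trans (ps_lipschitz aA r1 _ _) _; rewrite ?rE //.
  rewrite -mulrBr normcM normcR gtr0_norm // -/D.
  apply: (@le_lt_trans _ _ (normc (expi t - expi s) * (D + 1))); last first.
    by rewrite -ltr_pdivlMr // ltr_wpDl.
  apply: ler_pM => //; [|by rewrite ler_piMl ?normc_ge0 // ltW|by rewrite lerDl].
  by apply: mulr_ge0; rewrite ?normc_ge0 // ltW.
rewrite ltr_norml; apply/andP; split.
  rewrite ltrNl opprB; apply: le_lt_trans h4.
  by rewrite lerBlDr normc_distC -{1}(subrK (power_series a ((r%:C)%C * expi t))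
    (power_series a ((r%:C)%C * expi s))) normcD_le.
apply: le_lt_trans h4.
by rewrite lerBlDr -{1}(subrK (power_series a ((r%:C)%C * expi s))
    (power_series a ((r%:C)%C * expi t))) normcD_le.
Qed.

Lemma arc_mean_segment a A I r x y :
  (forall n, normc (a n) <= A) -> open_arc I -> 0 < r < 1 ->
  `[x, y]%classic `<=` arc_angles I ->
  (\int[lebesgue_measure]_(t in `[x, y])
     (normc (power_series a ((r%:C)%C * expi t)) / (2 * pi))%:E
   <= arc_mean (power_series a) I r)%E.
Proof.
move=> aA Io r01 xyI; apply: ge0_subset_integral => //.
- exact: measurable_arc_angles.
- apply/measurable_EFinP; apply: measurable_funTS.
  apply: measurable_funM => //; apply: continuous_measurable_fun.
  exact: continuous_ps_circle aA r01.
- by move=> t _; rewrite lee_fin divr_ge0 ?normc_ge0 // mulr_ge0 // pi_ge0.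
Qed.

Lemma arc_mean_bounded a A I :
  (forall n, normc (a n) <= A) -> open_arc I ->
  ereal_sup [set arc_mean (power_series a) I r | r in `]0, 1[ ] <> +oo%E ->
  exists2 B, 0 <= B & forall r, 0 < r < 1 ->
    (arc_mean (power_series a) I r <= B%:E)%E.
Proof.
move=> aA Io; set S := ereal_sup _ => Sy.
have ub r : 0 < r < 1 -> (arc_mean (power_series a) I r <= S)%E.
  by move=> r01; apply: ereal_sup_ubound; exists r => //=; rewrite in_itv.
have mean0 r : (0 <= arc_mean (power_series a) I r)%E.
  apply: integral_ge0 => t _.
  by rewrite lee_fin divr_ge0 ?normc_ge0 // mulr_ge0 // pi_ge0.
have half : 0 < (1 / 2 : R) < 1 by apply/andP; split; lra.
have := le_trans (mean0 _) (ub _ half).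
case: S ub Sy => [s ub _| //|//]; rewrite lee_fin => s0.
by exists s.
Qed.

End Arcs.

(** * Inverse square tails *)

Lemma inv_nat_small (R : realType) (D e : R) : 0 < e ->
  exists2 L, (0 < L)%N & D / L%:R < e.
Proof.
move=> e0; exists (Num.truncn (`|D| / e)).+1 => //.
rewrite ltr_pdivrMr // mulrC -ltr_pdivrMr //.
apply: le_lt_trans (_ : _ <= `|D| / e) _.
  by rewrite ler_wpM2r ?invr_ge0 ?ler_norm // ltW.
by rewrite truncnS_gt.
Qed.

Lemma bernoulli_le (R : realType) (r : R) m : 0 <= r <= 1 ->
  1 - r ^+ m <= m%:R * (1 - r).
Proof.
move=> /andP[r0 r1]; elim: m => [|m IH]; first by rewrite expr0 subrr mul0r.
rewrite exprS -natr1 mulrDl mul1r.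
have -> : 1 - r * r ^+ m = r * (1 - r ^+ m) + (1 - r) by ring.
rewrite lerD2r; apply: le_trans IH; rewrite ler_piMl // subr_ge0.
by rewrite exprn_ile1.
Qed.

(** Telescoping: 1 / (n + 1)^2 is at most 1 / n - 1 / (n + 1). *)
Lemma inv_sqr_tail (R : realType) (K M : nat) : (0 < K)%N ->
  \sum_(K <= n < M) (n.+1%:R ^+ 2)^-1 <= K%:R^-1 :> R.
Proof.
move=> K0; case: (leqP K M) => [KM|/ltnW MK]; last first.
  by rewrite big_geq // invr_ge0.
suff : \sum_(K <= n < M) (n.+1%:R ^+ 2)^-1 <= K%:R^-1 - M%:R^-1 :> R.
  by move/le_trans; apply; rewrite lerBlDr lerDl invr_ge0.
elim: M KM => [|M IH]; first by rewrite leqn0 => /eqP ->; rewrite big_geq ?subrr.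
rewrite leq_eqVlt => /orP[/eqP ->|]; first by rewrite big_geq // subrr.
rewrite ltnS => KM; rewrite big_nat_recr //=.
have x1 : (0 : R) < M%:R by rewrite ltr0n (leq_trans K0).
have key : (M.+1%:R ^+ 2)^-1 <= M%:R^-1 - M.+1%:R^-1 :> R.
  rewrite -natr1; set x := M%:R in x1 *.
  have -> : x^-1 - (x + 1)^-1 = (x * (x + 1))^-1.
    by field; rewrite !gt_eqF // addr_gt0.
  by rewrite lef_pV2 ?posrE ?mulr_gt0 ?exprn_gt0 ?addr_gt0 //; nra.
apply: le_trans (lerD (IH KM) key) _.
by rewrite addrA subrK.
Qed.

(** The majorant used for all tail estimates; the shift by one lets it cover the
    index 0 as well. *)
Definition inv_sqr_weight (R : realType) (E : R) (k : int) : R :=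
  E / (absz k).+1%:R ^+ 2.

Section Weight.
Context {R : realType}.
Variable E : R.
Hypothesis E0 : 0 <= E.
Local Notation weight := (inv_sqr_weight E).

Lemma sum_weight_shift (N M L : nat) : (0 < L)%N -> (L <= N)%N ->
  \sum_(0 <= i < M) weight (i + N)%N%:Z <= E / L%:R.
Proof.
move=> L0 LN; apply: (@le_trans _ _ (E * N%:R^-1)); last first.
  rewrite ler_wpM2l // lef_pV2 ?posrE ?ltr0n ?ler_nat //.
  exact: leq_trans LN.
have -> : \sum_(0 <= i < M) weight (i + N)%N%:Z =
    E * \sum_(N <= n < M + N) (n.+1%:R ^+ 2)^-1.
  by rewrite -{2}[N]add0n big_addn addnK mulr_sumr.
by rewrite ler_wpM2l // inv_sqr_tail // (leq_trans L0).
Qed.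

Lemma sum_weight_right (n : int) (K M L : nat) :
  (0 < L)%N -> L%:Z <= K%:Z + n ->
  \sum_(K <= m < M) weight (m%:Z + n) <= E / L%:R.
Proof.
move=> L0 LK; rewrite -{1}[K]add0n big_addn.
pose N := absz (K%:Z + n).
apply: le_trans (@sum_weight_shift N (M - K) L L0 _); last by rewrite /N; lia.
rewrite le_eqVlt; apply/orP; left; apply/eqP.
by apply: eq_bigr => i _; congr weight; rewrite /N; lia.
Qed.

Lemma sum_weight_left (N K L : nat) :
  (0 < L)%N -> (K + L <= N.+1)%N ->
  \sum_(0 <= m < K) weight (m%:Z - N%:Z) <= E / L%:R.
Proof.
move=> L0 KL; rewrite big_nat_rev add0n.
apply: le_trans (@sum_weight_shift (N.+1 - K) K L L0 _); last by lia.
rewrite le_eqVlt; apply/orP; left; apply/eqP.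
apply: eq_big_nat => i /andP[_ iK]; rewrite /inv_sqr_weight.
by congr (_ / (_.+1)%:R ^+ 2); lia.
Qed.

End Weight.

Lemma bump_coef_decay (R : realType) (h : R) : 0 < h ->
  exists2 E, 0 <= E & forall k, `|bump_coef h k| <= inv_sqr_weight E k.
Proof.
move=> h0; exists (16 * (h + 1) + 4 / 3 * h ^+ 3).
  by rewrite addr_ge0 ?mulr_ge0 ?addr_ge0 ?exprn_ge0 // ltW.
have h3 : 0 <= 4 / 3 * h ^+ 3 by rewrite mulr_ge0 ?exprn_ge0 // ltW.
move=> k; rewrite /bump_coef /inv_sqr_weight.
case: eqVneq => [->|k0].
  by rewrite ger0_norm // expr1n divr1 lerDr mulr_ge0 // addr_ge0 // ltW.
set x : R := (absz k)%:R.
have x1 : 1 <= x by rewrite ler1n; lia.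
have xE : `|k%:~R : R| = x by rewrite /x pmulrn abszE intr_norm.
have x0 : 0 < x by apply: lt_le_trans x1.
apply: (@le_trans _ _ (4 * (h + 1) / x ^+ 2)).
  apply: le_trans (ler_normD _ _) _; rewrite mulrDr mulrDl lerD //.
    rewrite !normrM normrV ?unitfE ?expf_neq0 ?intr_eq0 // normrX xE.
    rewrite ler_wpM2r ?invr_ge0 ?exprn_ge0 ?(ltW x0) //.
    rewrite normrN normr_nat gtr0_norm // ler_piMr ?mulr_ge0 ?(ltW h0) //.
    by rewrite ler_norml cos_geN1 cos_le1.
  rewrite !normrM normrV ?unitfE ?expf_neq0 ?intr_eq0 // normrX xE mulr1 normr_nat.
  have s1 : `|sin (k%:~R * h)| <= 1 by rewrite ler_norml sin_geN1 sin_le1.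
  apply: ler_pM; rewrite ?mulr_ge0 ?invr_ge0 ?exprn_ge0 ?(ltW x0) //.
    by rewrite ler_piMr.
  rewrite lef_pV2 ?posrE ?exprn_gt0 //.
  by rewrite [leRHS]exprS ler_peMl // exprn_ge0 ?ltW.
apply: (@le_trans _ _ (16 * (h + 1) / (x + 1) ^+ 2)); last first.
  rewrite -[(absz k).+1%:R]natr1 -/x.
  by rewrite ler_wpM2r ?invr_ge0 ?exprn_ge0 ?addr_ge0 ?(ltW x0) // lerDl.
rewrite ler_pdivrMr ?exprn_gt0 // mulrAC ler_pdivlMr ?exprn_gt0 ?addr_gt0 //.
rewrite (_ : 16 * (h + 1) * x ^+ 2 = 4 * (h + 1) * (4 * x ^+ 2)); last by ring.
rewrite ler_wpM2l ?mulr_ge0 ?addr_ge0 ?(ltW h0) //.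
nra.
Qed.

(** * Boundary coefficients of a power series *)

(** The Fourier coefficient of index - n of the boundary values of the power
    series multiplied by the bump; the boundary values themselves are formal. *)
Definition boundary_coef (R : realType) (a : nat -> R[i]) (h om : R) (n : int)
    : R[i] :=
  limn (series (fun m => a m * bump_fourier h om (m%:Z + n) : R[i]^o)).

(** The same coefficient on the circle of radius r, with K terms of the series. *)
Definition radial_coef (R : realType) (a : nat -> R[i]) (h om r : R) (K : nat)
    (n : int) : R[i] :=
  \sum_(0 <= m < K) a m * bump_fourier h om (m%:Z + n) * (r ^+ m)%:C%C.

Section BoundaryCoef.
Context {R : realType}.
Variables (a : nat -> R[i]) (A E h om : R).
Hypothesis aA : forall n, normc (a n) <= A.
Hypothesis E0 : 0 <= E.
Hypothesis decay : forall k, `|bump_coef h k| <= inv_sqr_weight E k.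
Local Notation c := (boundary_coef a h om).
Local Notation bf := (bump_fourier h om).
Local Notation weight := (inv_sqr_weight E).

Let A0 : 0 <= A. Proof. exact: le_trans (normc_ge0 _) (aA 0%N). Qed.

Lemma bump_term_le m k : normc (a m * bf k) <= A * weight k.
Proof.
rewrite normcM ler_pM ?normc_ge0 //.
by rewrite normcM normc_expi mul1r normcR.
Qed.

Lemma boundary_abs_tail (n : int) (K M L : nat) :
  (0 < L)%N -> L%:Z <= K%:Z + n ->
  \sum_(K <= m < M) normc (a m * bf (m%:Z + n)) <= A * (E / L%:R).
Proof.
move=> L0 LK; apply: (@le_trans _ _ (A * \sum_(K <= m < M) weight (m%:Z + n))).
  by rewrite mulr_sumr; apply: ler_sum => m _; exact: bump_term_le.
by rewrite ler_wpM2l // sum_weight_right.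
Qed.

Lemma cvg_boundary_coef n :
  cvgn (series (fun m => a m * bf (m%:Z + n) : R[i]^o)).
Proof.
pose K := (absz n).+1.
apply: (@cvg_series_normc _ _ (\sum_(0 <= m < K) normc (a m * bf (m%:Z + n))
   + A * (E / 1%:R))) => N.
apply: (@le_trans _ _ (\sum_(0 <= m < N + K) normc (a m * bf (m%:Z + n)))).
  rewrite [leRHS](@big_cat_nat _ _ _ N) ?leq_addr //= lerDl.
  by apply: sumr_ge0 => m _; exact: normc_ge0.
rewrite [leLHS](@big_cat_nat _ _ _ K) ?leq_addl //= lerD2l.
by apply: boundary_abs_tail => //; rewrite /K; lia.
Qed.

Lemma boundary_tail (n : int) (K L : nat) :
  (0 < L)%N -> L%:Z <= K%:Z + n ->
  normc (c n - \sum_(0 <= m < K) a m * bf (m%:Z + n)) <= A * (E / L%:R).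
Proof.
move=> L0 LK; apply: series_tail_le; first exact: cvg_boundary_coef.
by move=> M _; exact: boundary_abs_tail.
Qed.

(** The power series has no negative powers, so only the tail of the coefficients
    of the bump contributes. *)
Lemma boundary_coef_pos e : 0 < e -> \forall n \near \oo, normc (c n%:Z) < e.
Proof.
move=> e0; have [L L0 Le] := inv_nat_small (A * E) e0.
near=> n.
have := @boundary_tail n%:Z 0 L L0; rewrite big_geq // subr0.
have Ln : L%:Z <= 0%:Z + n%:Z.
  by rewrite add0r lez_nat; near: n; exact: nbhs_infty_ge.
by move/(_ Ln)/le_lt_trans; apply; rewrite mulrA.
Unshelve. all: by end_near. Qed.

(** Abel summation of the boundary coefficients: the tails are small uniformly
    in the radius. *)
Lemma radial_coef_approx n e : 0 < e -> exists2 r0, r0 < 1 &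
  forall r, 0 < r < 1 -> r0 < r ->
    \forall K \near \oo, normc (c n - radial_coef a h om r K n) < e.
Proof.
move=> e0; have e3 : 0 < e / 3 by rewrite divr_gt0.
have [L L0 Le] := inv_nat_small (A * E) e3; rewrite -mulrA in Le.
pose K0 := (L + absz n)%N.
have LK0 : L%:Z <= K0%:Z + n by rewrite /K0; lia.
pose U := \sum_(0 <= m < K0) normc (a m * bf (m%:Z + n)).
have U0 : 0 <= U by apply: sumr_ge0 => m _; exact: normc_ge0.
have D0 : 0 < K0%:R * U + 1 by rewrite ltr_wpDl // mulr_ge0.
exists (1 - e / 3 / (K0%:R * U + 1)); first by rewrite ltrBlDr ltrDl divr_gt0.
move=> r /andP[r0 r1] hr.
have rX m : `|r ^+ m| <= 1.
  by rewrite ger0_norm ?exprn_ge0 ?exprn_ile1 // ltW.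
exists K0 => // K /= K0K.
have -> : c n - radial_coef a h om r K n =
  (c n - \sum_(0 <= m < K0) a m * bf (m%:Z + n))
  + (\sum_(0 <= m < K0) a m * bf (m%:Z + n) * (1 - r ^+ m)%:C%C
     - \sum_(K0 <= m < K) a m * bf (m%:Z + n) * (r ^+ m)%:C%C).
  rewrite /radial_coef [in LHS](@big_cat_nat _ _ _ K0) //= opprD.
  have -> : \sum_(0 <= m < K0) a m * bf (m%:Z + n) * (1 - r ^+ m)%:C%C =
     \sum_(0 <= m < K0) a m * bf (m%:Z + n)
     - \sum_(0 <= m < K0) a m * bf (m%:Z + n) * (r ^+ m)%:C%C.
    by rewrite -sumrB; apply: eq_bigr => m _; rewrite rmorphB /= mulrBr mulr1.
  by ring.
have s1 : normc (c n - \sum_(0 <= m < K0) a m * bf (m%:Z + n)) < e / 3.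
  exact: le_lt_trans (boundary_tail L0 LK0) Le.
have s2 : normc (\sum_(0 <= m < K0) a m * bf (m%:Z + n) * (1 - r ^+ m)%:C%C)
    < e / 3.
  apply: (@le_lt_trans _ _ (U * (K0%:R * (1 - r)))).
    apply: le_trans (normc_sum_le _ _ _) _; rewrite /U mulr_suml.
    rewrite big_nat_cond [leRHS]big_nat_cond; apply: ler_sum => m.
    rewrite andbT => /andP[_ mK].
    rewrite normcM normcR ler_wpM2l ?normc_ge0 // ger0_norm.
      apply: le_trans (bernoulli_le _ _) _; first by rewrite !ltW.
      by rewrite ler_wpM2r ?subr_ge0 ?ler_nat ?(ltW r1) ?(ltnW mK).
    by rewrite subr_ge0 exprn_ile1 // ltW.
  rewrite mulrA [U * _]mulrC; apply: (@le_lt_trans _ _ ((K0%:R * U + 1) * (1 - r))).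
    by rewrite ler_wpM2r ?subr_ge0 ?lerDl // ltW.
  by rewrite mulrC -ltr_pdivlMr // ltrBlDr addrC -ltrBlDr.
have s3 : normc (\sum_(K0 <= m < K) a m * bf (m%:Z + n) * (r ^+ m)%:C%C) < e / 3.
  apply: le_lt_trans Le; apply: le_trans (boundary_abs_tail K L0 LK0).
  apply: le_trans (normc_sum_le _ _ _) _; apply: ler_sum => m _.
  by rewrite normcM normcR ler_piMr ?normc_ge0.
apply: le_lt_trans (normcD_le _ _) _.
have := normcB_le (\sum_(0 <= m < K0) a m * bf (m%:Z + n) * (1 - r ^+ m)%:C%C)
  (\sum_(K0 <= m < K) a m * bf (m%:Z + n) * (r ^+ m)%:C%C).
move: s1 s2 s3; set n1 := normc _; set n2 := normc _; set n3 := normc _.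
by set n4 := normc _; lra.
Qed.

Lemma trig_apply_radial_approx p e : 0 < e -> exists2 r0, r0 < 1 &
  forall r, 0 < r < 1 -> r0 < r -> \forall K \near \oo,
    normc (trig_apply c p - trig_apply (radial_coef a h om r K) p) < e.
Proof.
elim: p e => [|[x k] p IH] e e0.
  exists 0 => // r _ _; apply: nearW => K.
  by rewrite /trig_apply !big_nil subrr normc0.
have e2 : 0 < e / 2 by rewrite divr_gt0.
have x1 : 0 < normc x + 1 by rewrite ltr_wpDl ?normc_ge0.
have ex : 0 < e / 2 / (normc x + 1) by rewrite divr_gt0.
have [r1 r11 h1] := IH _ e2; have [r2 r21 h2] := radial_coef_approx k ex.
exists (Num.max r1 r2) => [|r r01]; first by rewrite gt_max r11.
rewrite gt_max => /andP[rr1 rr2].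
apply: filterS2 (h1 _ r01 rr1) (h2 _ r01 rr2) => K k1 k2.
rewrite !trig_apply_cons opprD addrACA -mulrBr.
apply: le_lt_trans (normcD_le _ _) _; rewrite [ltRHS]splitr ltrD //.
rewrite normcM; apply: le_lt_trans (ler_wpM2l (normc_ge0 _) (ltW k2)) _.
by rewrite mulrA ltr_pdivrMr // mulrC ltr_pM2l // ltrDl.
Qed.

(** On a circle of radius r the truncated coefficients are those of the product of
    [p] with a partial sum of the series, which differs from its sum by a
    geometric tail. *)
Lemma radial_functional_le r B K p : 0 < h -> 0 < r < 1 ->
  (\int[lebesgue_measure]_(t in `[(om - h)%R, (om + h)%R])
     ((normc (power_series a ((r%:C)%C * expi t)) / (2 * pi))%R)%:E <= B%:E)%E ->
  (forall t, normc (trig_eval p t) <= 1) ->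
  normc (trig_apply (radial_coef a h om r K) p) <=
  h ^+ 2 * (2 * pi) * B + h ^+ 2 * (A * (r ^+ K / (1 - r))) * (2 * h).
Proof.
move=> h0 r01 fB p1; have [r0 r1] := andP r01.
have pi0 : 0 < 2 * pi :> R by rewrite mulr_gt0 ?pi_gt0.
pose q := [seq (x.1 * (a m * (r ^+ m)%:C%C), m%:Z + x.2) |
            x <- p, m <- index_iota 0 K].
have -> : trig_apply (radial_coef a h om r K) p = trig_apply bf q.
  rewrite /trig_apply /q big_allpairs_dep; apply: eq_bigr => x _.
  rewrite /radial_coef mulr_sumr; apply: eq_bigr => m _ /=.
  by ring.
have qE t : trig_eval q t =
    trig_eval p t * \sum_(0 <= m < K) a m * ((r%:C)%C * expi t) ^+ m.
  rewrite /trig_eval /trig_apply /q big_allpairs_dep mulr_suml.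
  apply: eq_bigr => x _; rewrite mulr_sumr; apply: eq_bigr => m _ /=.
  rewrite exprMn expiX intrD mulrDl expiD rmorphXn /=.
  have -> : (m%:Z)%:~R = m%:R :> R by [].
  by ring.
pose F t := normc (power_series a ((r%:C)%C * expi t)) / (2 * pi).
pose d := A * (r ^+ K / (1 - r)).
have d0 : 0 <= d.
  by rewrite mulr_ge0 // divr_ge0 ?exprn_ge0 ?subr_ge0 // ltW.
have qle t : normc (trig_eval q t) <= 2 * pi * F t + d.
  have rE : normc ((r%:C)%C * expi t) = r.
    by rewrite normcM normcR normc_expi mulr1 gtr0_norm.
  rewrite qE normcM; apply: le_trans (_ : _ <= 1 * _) _.
    by apply: ler_wpM2r; [exact: normc_ge0|exact: p1].
  have -> : 2 * pi * F t = normc (power_series a ((r%:C)%C * expi t)).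
    by rewrite /F mulrC divfK // gt_eqF.
  rewrite mul1r addrC -lerBlDr.
  have := @ps_tail _ a A ((r%:C)%C * expi t) K aA; rewrite rE => /(_ r1).
  apply: le_trans; rewrite lerBlDr normc_distC.
  apply: le_trans (normcD_le _ _); rewrite subrK.
  exact: lexx.
have F0 t : 0 <= F t by rewrite divr_ge0 ?normc_ge0 // ltW.
have mF : measurable_fun (`[om - h, om + h]%classic) (EFin \o F).
  apply/measurable_EFinP; apply: measurable_funTS.
  apply: measurable_funM => //; apply: continuous_measurable_fun.
  exact: continuous_ps_circle aA r01.
have mD : measurable (`[om - h, om + h]%classic : set R) by [].
rewrite -lee_fin; apply: le_trans (bump_functional_le _ _ h0) _.
apply: (@le_trans _ _ (\int[lebesgue_measure]_(t in `[(om - h)%R, (om + h)%R])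
   ((h ^+ 2 * (2 * pi))%:E * (F t)%:E + cst (h ^+ 2 * d)%:E t))%E).
  apply: ge0_le_integral => //.
  - by move=> t _; rewrite lee_fin mulr_ge0 ?sqr_ge0 ?normc_ge0.
  - apply/measurable_EFinP; apply: measurable_funTS.
    apply: measurable_funM => //; apply: continuous_measurable_fun.
    by apply: continuous_normc; case: (continuous_trig_eval q).
  - apply: emeasurable_funD => //; exact: measurable_funeM.
  - move=> t _; rewrite /cst -EFinM -EFinD lee_fin.
    rewrite -[X in _ <= X + _]mulrA -mulrDr.
    by rewrite ler_wpM2l ?sqr_ge0.
have hp0 : 0 <= h ^+ 2 * (2 * pi) by rewrite mulr_ge0 ?sqr_ge0 // ltW.
rewrite ge0_integralD //; first last.
- by move=> t _; rewrite lee_fin mulr_ge0 ?sqr_ge0.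
- exact: measurable_funeM.
- by move=> t _; rewrite mule_ge0 // lee_fin.
rewrite EFinD leeD //.
  rewrite ge0_integralZl_EFin //; last by move=> t _; rewrite lee_fin.
  by rewrite [leRHS]EFinM lee_wpmul2l // lee_fin.
rewrite integral_cst // [X in (_ * X <= _)%E](_ : _ = (2 * h)%:E).
  by rewrite -EFinM.
rewrite [LHS](@lebesgue_measure_itv R) /= lte_fin.
have -> : om - h < om + h by lra.
by rewrite -EFinB; congr EFin; ring.
Qed.

(** A uniform bound on the means over the arc passes to the boundary: the cut-off
    boundary values are a bounded functional of the trigonometric polynomial. *)
Lemma boundary_functional_le B p : 0 < h ->
  (forall r, 0 < r < 1 ->
     (\int[lebesgue_measure]_(t in `[(om - h)%R, (om + h)%R])
       ((normc (power_series a ((r%:C)%C * expi t)) / (2 * pi))%R)%:E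
     <= B%:E)%E) ->
  (forall t, normc (trig_eval p t) <= 1) ->
  normc (trig_apply c p) <= h ^+ 2 * (2 * pi) * B.
Proof.
move=> h0 fB p1; apply/ler_addgt0Pr => e e0.
have e2 : 0 < e / 2 by rewrite divr_gt0.
have [r0 r01 approx] := trig_apply_radial_approx p e2.
pose r := Num.max (1 / 2) ((1 + r0) / 2).
have rr : 0 < r < 1.
  rewrite lt_max gt_max; apply/andP; split; first by apply/orP; left; lra.
  by apply/andP; split; lra.
have r0r : r0 < r by rewrite lt_max; apply/orP; right; lra.
have [rp r1] := andP rr.
have small : (h ^+ 2 * (A * (r ^+ K / (1 - r))) * (2 * h)) @[K --> \oo]
    --> (0 : R).
  have -> : (fun K => h ^+ 2 * (A * (r ^+ K / (1 - r))) * (2 * h)) =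
      (fun K => (h ^+ 2 * A / (1 - r) * (2 * h)) * r ^+ K).
    by apply/funext => K; ring.
  rewrite -(mulr0 (h ^+ 2 * A / (1 - r) * (2 * h))).
  apply: cvgM; first exact: cvg_cst.
  by apply: cvg_expr; rewrite gtr0_norm.
move/cvgrPdist_lt/(_ _ e2) : small => small.
have [K [k1 k2]] := filter_ex (filterI (approx r rr r0r) small).
rewrite sub0r normrN in k2; have {}k2 := le_lt_trans (ler_norm _) k2.
have := radial_functional_le K h0 rr (fB r rr) p1.
have := normcD_le (trig_apply c p - trig_apply (radial_coef a h om r K) p)
  (trig_apply (radial_coef a h om r K) p).
rewrite subrK; move: k1 k2; set n1 := normc _; set n2 := normc _.
by set n3 := normc _; set n4 := _ * (2 * h); lra.
Qed.

(** The boundary coefficients define a bounded functional and tend to 0 at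
    + infinity, so the theorem on one-sided decay applies. *)
Lemma boundary_coef_neg B e : 0 < h ->
  (forall r, 0 < r < 1 ->
     (\int[lebesgue_measure]_(t in `[(om - h)%R, (om + h)%R])
       ((normc (power_series a ((r%:C)%C * expi t)) / (2 * pi))%R)%:E
     <= B%:E)%E) ->
  0 < e -> \forall n \near \oo, normc (c (- n%:Z)) < e.
Proof.
move=> h0 fB; apply: (@rajchman _ c (h ^+ 2 * (2 * pi) * B)).
  by move=> p; exact: boundary_functional_le.
exact: boundary_coef_pos.
Qed.

End BoundaryCoef.

(** * Constant term of a polynomial small on an arc *)

Section RootsOfUnity.
Context {R : realType}.

Lemma expi_neq1 (t : R) : 0 < t < 2 * pi -> expi t != 1.
Proof.
move=> /andP[t0 t1]; apply/negP => /eqP /(congr1 (complex.Re (R := R))) /= c1.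
have s0 : 0 < sin (t / 2).
  by apply: sin_gt0_pi; rewrite divr_gt0 // ltr_pdivrMr // mulrC.
have : cos t = 1 - 2 * sin (t / 2) ^+ 2.
  rewrite [t in LHS]splitr cosD -!expr2 cos2sin2; ring.
by rewrite c1; have := exprn_gt0 2 s0; lra.
Qed.

(** Mean value property over the M-th roots of unity: the mean of z^k vanishes for
    0 < k < M. *)
Lemma poly_mean_roots (p : {poly R[i]}) (M : nat) : (0 < M)%N ->
  (size p <= M)%N ->
  \sum_(s < M) p.[expi (s%:R * (2 * pi / M%:R))] = M%:R * p.[0].
Proof.
move=> M0 pM; pose z : R[i] := expi (2 * pi / M%:R : R).
have Mr : (0 : R) < M%:R by rewrite ltr0n.
have zM : z ^+ M = 1.
  rewrite /z expiX mulrC divfK ?gt_eqF //.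
  by rewrite -(expi_period _ (-1)) mulN1r subrr expi0.
have zk k : (0 < k < M)%N -> \sum_(s < M) (z ^+ s) ^+ k = 0.
  move=> /andP[k0 kM]; have zk1 : z ^+ k - 1 != 0.
    rewrite subr_eq0 /z expiX; apply: expi_neq1.
    rewrite mulr_gt0 ?divr_gt0 ?mulr_gt0 ?pi_gt0 ?ltr0n //=.
    rewrite mulrA ltr_pdivrMr // mulrC ltr_pM2l ?mulr_gt0 ?pi_gt0 //.
    by rewrite ltr_nat.
  apply: (mulfI zk1); rewrite mulr0.
  under eq_bigr do rewrite -exprM mulnC exprM.
  by rewrite -subrX1 -exprM mulnC exprM zM expr1n subrr.
under eq_bigr do rewrite -expiX (horner_coef_wide _ pM).
rewrite exchange_big /= (bigD1 (Ordinal M0)) //= [X in _ + X]big1 ?addr0.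
  under eq_bigr do rewrite expr0 mulr1.
  by rewrite sumr_const card_ord horner_coef0 mulr_natl.
move=> i i0; rewrite -mulr_sumr zk ?mulr0 // ltn_ord andbT lt0n.
by apply: contra i0 => /eqP i0; apply/eqP/val_inj.
Qed.

Lemma poly_max_roots (p : {poly R[i]}) (M : nat) (eta : R) : (0 < M)%N ->
  (size p <= M)%N ->
  (forall s : 'I_M, normc p.[expi (s%:R * (2 * pi / M%:R))] <= eta) ->
  normc p.[0] <= eta.
Proof.
move=> M0 pM peta; have Mr : (0 : R) < M%:R by rewrite ltr0n.
rewrite -(ler_pM2l Mr) -[M%:R in leLHS](ger0_norm (ltW Mr)) -normcR -normcM.
rewrite rmorph_nat -poly_mean_roots //.
apply: le_trans (normc_sum_le _ _ _) _.
apply: le_trans (ler_sum _ (fun s _ => peta s)) _.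
by rewrite sumr_const card_ord mulr_natl.
Qed.

(** If a polynomial is at most [C] on the unit circle and small at one of the N
    rotations of each test point, the product of its N rotations is small at
    every test point, hence so is the N-th power of the constant term. *)
Lemma constant_term_le (b : nat -> R[i]) (K N : nat) (C eta : R) :
  (0 < N)%N -> 1 <= C ->
  (forall t : R, normc (\sum_(0 <= k < K) b k * expi t ^+ k) <= C) ->
  (forall s : 'I_((N * K).+1), exists l : 'I_N,
     normc (\sum_(0 <= k < K) b k *
       expi (s%:R * (2 * pi / (N * K).+1%:R) + l%:R * (2 * pi / N%:R)) ^+ k)
     <= eta) ->
  (0 < K)%N -> normc (b 0%N) ^+ N <= eta * C ^+ N.
Proof.
move=> N0 C1 bC small K0; set M := (N * K).+1 in small *.
pose w l : {poly R[i]} :=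
  \poly_(k < K) (b k * expi (l%:R * (2 * pi / N%:R)) ^+ k).
have wE l (t : R) : (w l).[expi t] =
    \sum_(0 <= k < K) b k * expi (t + l%:R * (2 * pi / N%:R)) ^+ k.
  rewrite horner_poly big_mkord; apply: eq_bigr => k _.
  by rewrite expiD exprMn; ring.
pose W := \prod_(l < N) w l.
have sW : (size W <= M)%N.
  apply: leq_trans (size_prod_leq _ _) _.
  have : (\sum_(l < N) size (w l) <= N * K)%N.
    rewrite -[N in (N * K)%N]card_ord -sum_nat_const.
    by apply: leq_sum => l _; exact: size_poly.
  by rewrite /M /=; lia.
have W0 : W.[0] = b 0%N ^+ N.
  rewrite /W horner_prod -[N in RHS]card_ord -prodr_const.
  apply: eq_bigr => l _; rewrite horner_coef0 coef_poly K0.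
  by rewrite expr0 mulr1.
rewrite -normcX_eq -W0; apply: (poly_max_roots _ sW) => // s.
rewrite /W horner_prod; have [l0 hl0] := small s.
have normc_prod (P : pred 'I_N) (F : 'I_N -> R[i]) :
    normc (\prod_(l | P l) F l) = \prod_(l | P l) normc (F l).
  by apply: (big_morph _ (@normcM R) (@normc1 R)).
rewrite (bigD1 l0) //= normcM.
apply: ler_pM; rewrite ?normc_ge0 ?wE // normc_prod.
apply: (@le_trans _ _ (\prod_(l < N | l != l0) C)).
  by apply: ler_prod => l _; rewrite normc_ge0 wE bC.
rewrite prodr_const ler_weXn2l //.
by apply: leq_trans (max_card _) _; rewrite card_ord.
Qed.

(** The multiples of 2 pi / N form a net of mesh at most [d]; the index of the
    rotation is then reduced modulo N, which changes the angle by a multiple of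
    2 pi. *)
Lemma rotate_into_arc (x d t : R) (N : nat) : (0 < N)%N -> 2 * pi / N%:R <= d ->
  exists om, exists l : 'I_N,
    x <= om <= x + d /\ expi (t + l%:R * (2 * pi / N%:R)) = expi om.
Proof.
move=> N0 Nd; have Nr : (0 : R) < N%:R by rewrite ltr0n.
pose g : R := 2 * pi / N%:R.
have g0 : 0 < g by rewrite divr_gt0 // mulr_gt0 // pi_gt0.
pose j := Num.floor ((x - t) / g) + 1.
have j1 : x - t < j%:~R * g by rewrite -ltr_pdivrMr // floorD1_gt.
have j2 : j%:~R * g <= x - t + g.
  rewrite intrD mulrDl mul1r lerD2r -ler_pdivlMr //; exact: floor_le.
have lN : (absz (j %% N%:Z)%Z < N)%N.
  have : (0 <= j %% N%:Z)%Z by rewrite modz_ge0 // eqz_nat -lt0n.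
  have : (j %% N%:Z < N%:Z)%Z by rewrite ltz_pmod.
  by lia.
exists (t + j%:~R * g), (Ordinal lN); split.
  by apply/andP; split; move: Nd j1 j2; rewrite -/g; lra.
have jE : j%:~R * g = (absz (j %% N%:Z)%Z)%:R * g + (j %/ N%:Z)%Z%:~R * (2 * pi).
  rewrite {1}(divz_eq j N%:Z) intrD intrM mulrDl addrC; congr (_ + _).
    have : (0 <= j %% N%:Z)%Z by rewrite modz_ge0 // eqz_nat -lt0n.
    by move=> h; rewrite -[X in X%:~R * _](gez0_abs h).
  by rewrite -mulrA /g; congr (_ * _); rewrite mulrC divfK // gt_eqF.
by rewrite jE addrA expi_period.
Qed.

End RootsOfUnity.

(** * The coefficients around a given index *)

Section RightPart.
Context {R : realType}.
Variables (a : nat -> R[i]) (A E h om : R).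
Hypothesis aA : forall n, normc (a n) <= A.
Hypothesis E0 : 0 <= E.
Hypothesis decay : forall k, `|bump_coef h k| <= inv_sqr_weight E k.
Local Notation c := (boundary_coef a h om).
Local Notation bf := (bump_fourier h om).

(** Seen from the index n, a boundary coefficient far to the left is the value
    at [expi om] of a fixed-degree polynomial in the coefficients at and after n,
    up to the tails and up to the few coefficients just before n. *)
Lemma right_part_le n K L (eps : R) :
  (0 < L)%N -> (L <= n)%N -> (L <= K)%N -> 0 <= eps ->
  (forall i, (i < L)%N -> normc (a (n - L + i)%N) <= eps) ->
  normc (\sum_(0 <= k < K) a (n + k)%N * (bump_coef h k%:Z)%:C%C * expi om ^+ k)
  <= normc (c (- n%:Z)) + A * (E / L%:R) + A * (E / L%:R) + eps * (L%:R * E).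
Proof.
move=> L0 Ln LK eps0 before.
have A0 : 0 <= A := le_trans (normc_ge0 _) (aA 0%N).
pose f m := a m * bf (m%:Z - n%:Z).
have wE : \sum_(0 <= k < K) a (n + k)%N * (bump_coef h k%:Z)%:C%C * expi om ^+ k =
    \sum_(n <= m < n + K) f m.
  have -> : \sum_(n <= m < n + K) f m = \sum_(0 <= k < K) f (k + n)%N.
    by rewrite -{1}[n]add0n big_addn addKn.
  apply: eq_bigr => k _.
  rewrite /f addnC /bump_fourier expiX.
  have -> : (k + n)%N%:Z - n%:Z = k%:Z by lia.
  by rewrite pmulrn; ring.
have LKn : L%:Z <= (n + K)%N%:Z - n%:Z by lia.
have t1 := @boundary_tail R a A E h om aA E0 decay _ _ _ L0 LKn.
have t2 : normc (\sum_(0 <= m < n - L) f m) <= A * (E / L%:R).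
  apply: le_trans (normc_sum_le _ _ _) _.
  apply: (@le_trans _ _ (A * \sum_(0 <= m < n - L) inv_sqr_weight E (m%:Z - n%:Z))).
    by rewrite mulr_sumr; apply: ler_sum => m _; exact: bump_term_le.
  by rewrite ler_wpM2l // sum_weight_left //; lia.
have t3 : normc (\sum_(n - L <= m < n) f m) <= eps * (L%:R * E).
  rewrite -{1}[(n - L)%N]add0n big_addn subKn //.
  apply: le_trans (normc_sum_le _ _ _) _.
  apply: (@le_trans _ _ (\sum_(0 <= i < L) eps * E)).
    rewrite big_nat_cond [leRHS]big_nat_cond; apply: ler_sum => i.
    rewrite andbT => /andP[_ iL]; rewrite normcM.
    apply: ler_pM; rewrite ?normc_ge0 // 1?addnC ?before //.
    rewrite normcM normc_expi mul1r normcR; apply: le_trans (decay _) _.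
    rewrite /inv_sqr_weight ler_pdivrMr ?exprn_gt0 // ler_peMr // expr_ge1 //.
    by rewrite ler1n.
  rewrite sumr_const_nat subn0 -mulr_natl le_eqVlt.
  by apply/orP; left; apply/eqP; ring.
rewrite wE.
have -> : \sum_(n <= m < n + K) f m = c (- n%:Z)
    - (c (- n%:Z) - \sum_(0 <= m < n + K) f m)
    - \sum_(0 <= m < n - L) f m - \sum_(n - L <= m < n) f m.
  rewrite [\sum_(0 <= m < n + K) f m](@big_cat_nat _ _ _ n) ?leq_addr //=.
  rewrite [\sum_(0 <= m < n) f m](@big_cat_nat _ _ _ (n - L)) ?leq_subr //=.
  by ring.
apply: le_trans (normcB_le _ _) _; rewrite lerD //.
apply: le_trans (normcB_le _ _) _; rewrite lerD //.
by apply: le_trans (normcB_le _ _) _; rewrite lerD2l.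
Qed.

End RightPart.

Lemma limn_einf_gt0 (R : realType) (u : nat -> R) :
  (0 < limn_einf (fun j => (u j)%:E))%E ->
  exists2 d : R, 0 < d & \forall j \near \oo, d <= u j.
Proof.
rewrite limn_einf_lim (cvg_lim _ (@cvg_einfs_sup _ _)) //.
case/ereal_sup_gt => _ [n _ <-]; rewrite /einfs /=.
set i := ereal_inf _ => i0.
have lb j : (n <= j)%N -> (i <= (u j)%:E)%E.
  by move=> nj; apply: ereal_inf_lbound; exists j.
have := lb n (leqnn n); case: i i0 lb => [d d0 lb _| //|//].
by exists d => //; exists n => // j /= nj; rewrite -lee_fin lb.
Qed.

Lemma bounded_normc (R : realType) (a : nat -> R[i]) :
  (ereal_sup (range (fun n => (normc (a n))%:E)) < +oo)%E ->
  exists A, forall n, normc (a n) <= A.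
Proof.
set S := ereal_sup _ => Sy.
have ub n : ((normc (a n))%:E <= S)%E by apply: ereal_sup_ubound; exists n.
have := ub 0%N; case: S Sy ub => [A _ ub _| //|//].
by exists A => n; rewrite -lee_fin.
Qed.

(** * Strong natural boundary *)

Unset Implicit Arguments.
Set Strict Implicit.

Theorem theorem1p6 (R : realType) (a : nat -> R[i]) (nj : nat -> int)
    (a_bounded : (ereal_sup (range (fun n => (normc (a n))%:E)) < +oo)%E)
    (nj_infty : ((nj j)%:~R : R) @[j --> \oo] --> +oo)
    (left_limit : forall k : int, k < 0 ->
       at_int a (nj j + k) @[j --> \oo] --> (0 : R[i]^o))
    (liminf_pos :
       (0 < limn_einf (fun j => (normc (at_int a (nj j)))%:E))%E) :
  strong_natural_boundary (power_series a).
Proof.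
have [A aA] := bounded_normc a_bounded.
have A0 : 0 <= A := le_trans (normc_ge0 _) (aA 0%N).
have [d d0 near_d] := limn_einf_gt0 liminf_pos.
split=> [|I Io]; first exact: ps_analytic aA.
apply: contrapT => sup_fin.
have [B B0 meanB] := arc_mean_bounded aA Io sup_fin.
have [x [y [xy xyI]]] := arc_angles_segment Io.
(* bumps of half-width [h] centred anywhere in a segment of length [2 * h] all
   have their support in [x, y] *)
pose h := (y - x) / 4.
have h0 : 0 < h by rewrite divr_gt0 // subr_gt0.
have intB om : x + h <= om <= x + h + 2 * h ->
    forall r, 0 < r < 1 -> (\int[lebesgue_measure]_(t in `[(om - h)%R, (om + h)%R])
       ((normc (power_series a ((r%:C)%C * expi t)) / (2 * pi))%R)%:E <= B%:E)%E.
  move=> omI r r01; apply: le_trans (meanB _ r01).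
  apply: arc_mean_segment aA Io r01 _; apply: subset_trans xyI => t.
  move: omI; rewrite /= !in_itv /= /h => /andP[h1 h2] /andP[h3 h4].
  by apply/andP; split; lra.
have [E E0 decay] := bump_coef_decay h0.
have [N N0 Nh] : exists2 N, (0 < N)%N & 2 * pi / N%:R < 2 * h.
  by apply: inv_nat_small; rewrite mulr_gt0.
pose C := A * (E + E) + 1.
have C1 : 1 <= C by rewrite lerDr mulr_ge0 ?addr_ge0.
have C0 : 0 < C ^+ N by rewrite exprn_gt0 // (lt_le_trans _ C1).
pose b0 := d * bump_coef h 0.
have b00 : 0 < b0.
  by rewrite mulr_gt0 // /bump_coef eqxx mulr_gt0 ?exprn_gt0 // divr_gt0.
(* the factor 1 / 8 makes [4 * eta * C ^+ N] half of [b0 ^+ N], a lower bound for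
   the N-th power of the constant term *)
pose eta := b0 ^+ N / C ^+ N / 8.
have eta0 : 0 < eta by rewrite !divr_gt0 // exprn_gt0.
have [L L0 Leta] := inv_nat_small (A * E) eta0; rewrite -mulrA in Leta.
pose eps := eta / (L%:R * E + 1).
have LE0 : 0 < L%:R * E + 1 by rewrite ltr_wpDl // mulr_ge0.
have eps0 : 0 < eps by rewrite divr_gt0.
pose M := (N * L).+1.
have /choice[om omP] : forall s : 'I_M, exists om, exists l : 'I_N,
    x + h <= om <= x + h + 2 * h /\
    expi (s%:R * (2 * pi / M%:R) + l%:R * (2 * pi / N%:R)) = expi om.
  by move=> s; exact: rotate_into_arc N0 (ltW Nh).
have coef_small : \forall n \near \oo, forall s : 'I_M,
    normc (boundary_coef a h (om s) (- n%:Z)) < eta.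
  apply: filter_forall => s; have [l [omI _]] := omP s.
  exact: (boundary_coef_neg aA E0 decay h0 (intB _ omI) eta0).
have [n0 _ hn0] := coef_small.
have before : \forall j \near \oo, forall i : 'I_L,
    normc (at_int a (nj j + (i%:Z - L%:Z))) < eps.
  apply: filter_forall => i.
  have iL : i%:Z - L%:Z < 0 by rewrite subr_lt0 ltz_nat.
  have /cvgc_normP/(_ _ eps0) := left_limit _ iL.
  by apply: filterS => j; rewrite subr0.
have nj_large : \forall j \near \oo, ((n0 + L)%N%:Z)%:~R <= (nj j)%:~R :> R.
  by have /cvgryPge := nj_infty; apply.
(* the finitely many centres [om s] were fixed before the index j, so one j serves
   all of them *)
have [j [hd [hb hl]]] := filter_ex (filterI near_d (filterI before nj_large)).
rewrite ler_int in hl.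
have [n njn] : exists n : nat, nj j = n%:Z.
  by case: (nj j) hl => [m _|//]; exists m.
rewrite njn in hd hb hl.
have Ln : (L <= n)%N := leq_trans (leq_addl _ _) hl.
have n0n : (n0 <= n)%N := leq_trans (leq_addr _ _) hl.
have hb' i : (i < L)%N -> normc (a (n - L + i)%N) <= eps.
  move=> iL; have := hb (Ordinal iL).
  have -> : n%:Z + ((Ordinal iL)%:Z - L%:Z) = (n - L + i)%N%:Z 
    by rewrite PoszD -subzn //=; ring.
  by move=> /= /ltW.
pose b k := a (n + k)%N * (bump_coef h k%:Z)%:C%C.
(* four contributions of size [eta]: the boundary coefficient, the two tails and
   the coefficients just before the index n *)
have w_small s : normc (\sum_(0 <= k < L) b k * expi (om s) ^+ k) <= 4 * eta.
  have := right_part_le (om s) aA E0 decay L0 Ln (leqnn L) (ltW eps0) hb'.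
  move/le_trans; apply.
  have h1 := hn0 n n0n s.
  have h2 : eps * (L%:R * E) <= eta.
    by rewrite /eps mulrAC ler_pdivrMr // ler_wpM2l ?(ltW eta0) // lerDl.
  by move: h1 h2 Leta; set u := normc _; set v := A * (E / _); set z := eps * _; lra.
have w_bound t : normc (\sum_(0 <= k < L) b k * expi t ^+ k) <= C.
  apply: le_trans (normc_sum_le _ _ _) _.
  apply: (@le_trans _ _ (A * \sum_(0 <= k < L) inv_sqr_weight E k%:Z)).
    rewrite mulr_sumr; apply: ler_sum => k _.
    rewrite !normcM normcX_eq normc_expi expr1n mulr1 normcR.
    by apply: ler_pM; rewrite ?normc_ge0.
  apply: le_trans (_ : _ <= A * (E + E)) _; last by rewrite lerDl.
  rewrite ler_wpM2l // big_ltn // lerD //.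
    by rewrite /inv_sqr_weight expr1n divr1.
  have := @sum_weight_right R E E0 0 1 L 1 isT isT.
  rewrite divr1 => /(le_trans _); apply.
  by rewrite le_eqVlt; apply/orP; left; apply/eqP/eq_bigr => k _; rewrite addr0.
have small (s : 'I_M) : exists l : 'I_N,
    normc (\sum_(0 <= k < L) b k *
      expi (s%:R * (2 * pi / M%:R) + l%:R * (2 * pi / N%:R)) ^+ k) <= 4 * eta.
  have [l [_ sE]] := omP s; exists l.
  by under eq_bigr do rewrite sE; exact: w_small.
have := constant_term_le N0 C1 w_bound small L0.
have b0le : b0 ^+ N <= normc (b 0%N) ^+ N.
  rewrite ler_pXn2r ?nnegrE ?normc_ge0 ?(ltW b00) //.
  rewrite /b addn0 normcM normcR /b0.
  apply: ler_pM => //; [exact: ltW| |exact: ler_norm].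
  by rewrite /bump_coef eqxx mulr_ge0 ?exprn_ge0 ?(ltW h0) // divr_ge0.
move/(le_trans b0le).
have -> : 4 * eta * C ^+ N = b0 ^+ N / 2.
  by rewrite /eta; field; rewrite gt_eqF // (lt_le_trans _ C1).
have : 0 < b0 ^+ N by rewrite exprn_gt0.
by lra.
Qed.
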